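(* Let $\nu>0$ with $\nu\ne2$ be fixed. Consider the numerical method $$\begin{pmatrix}P_{n+1}\\Q_{n+1}\end{pmatrix}=A(h)\begin{pmatrix}P_n\\Q_n\end{pmatrix}+\sqrt\epsilon\,b(h)\,\Delta W_n,\quad n=0,1,2,\dots$$ with step-size $h>0$ approximating the Langevin equation $dP=-Q\,dt-\nu P\,dt+\sqrt\epsilon\,dW$, $dQ=P\,dt$ (the case $V(q)=\frac12q^2$), where $A=(a_{ij})_{i,j=1,2}$ and $b=(b_1,b_2)^\top$ satisfy, as $h\to0$, $$|a_{11}-1+\nu h|+|a_{12}+h|+|a_{21}-h|+|a_{22}-1|=\mathcal O(h^2),\qquad |b_1-1|+|b_2|=\mathcal O(h).$$ Then: (1) For all sufficiently small $h>0$, the family $\{\mu^h_{\nu,\epsilon}\}_{\epsilon>0}$ of invariant measures of the method satisfies a large deviations principle (as $\epsilon\to0$) with the good rate function $$I^h(p,q):=\frac{\big((\mathrm{tr}(A))^2-4\det(A)\big)\big(\Sigma_{22}p^2+\Sigma_{11}q^2-2\Sigma_{12}pq\big)}{2h\big(\Sigma_{11}\Sigma_{22}-\Sigma_{12}^2\big)},$$ where $\Sigma_{11},\Sigma_{22},\Sigma_{12}$ are the quantities defined in the context. (2) The numerical method asymptotically preserves the LDP of $\{\mu_{\nu,\epsilon}\}_{\epsilon>0}$, i.e., $$\lim_{h\to0}I^h(p,q)=\nu(p^2+q^2)\qquad\text{for all }(p,q)\in\mathbb R^2.$$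
   Context: Method: $W$ is a one-dimensional standard Wiener process, $t_n=nh$, $\Delta W_n=W(t_{n+1})-W(t_n)$, and $(P_0,Q_0)=(P(0),Q(0))=(p,q)\in\mathbb R^2$ is a deterministic initial value. The entries $a_{ij},b_i:(0,\infty)\to\mathbb R$ are functions of $h$ which may depend on $\nu$ but not on $\epsilon$; the argument $h$ is omitted. $f(h)=\mathcal O(h^p)$ means $|f(h)|\le Ch^p$ for all sufficiently small $h>0$ with $C>0$ independent of $h$. Invariant measure: a probability measure $\mu$ on $\mathbb R^2$ is invariant for the Markov chain $\{(P_n,Q_n)\}$ if $\int \mathbf E[\varphi(P_n,Q_n)\mid (P_0,Q_0)=x]\,\mu(dx)=\int\varphi\,d\mu$ for all bounded continuous $\varphi$ and all $n$. For all sufficiently small $h>0$ and any $\epsilon>0$ the method has a unique invariant measure, denoted $\mu^h_{\nu,\epsilon}$. Let $\lambda_{1,2}=\frac12\big(\mathrm{tr}(A)\pm\sqrt{(\mathrm{tr}(A))^2-4\det(A)}\big)$ (possibly complex) be the eigenvalues of $A$, and $$\Sigma_{11}=\tfrac{(a_{12}b_2+b_1(a_{11}-\lambda_2))^2}{1-\lambda_1^2}+\tfrac{(a_{12}b_2+b_1(a_{11}-\lambda_1))^2}{1-\lambda_2^2}+\tfrac{2a_{12}a_{21}b_1^2-2a_{12}^2b_2^2+2a_{12}b_1b_2(a_{22}-a_{11})}{1-\lambda_1\lambda_2},$$ $$\Sigma_{22}=\tfrac{(a_{21}b_1+b_2(\lambda_1-a_{11}))^2}{1-\lambda_1^2}+\tfrac{(a_{21}b_1+b_2(\lambda_2-a_{11}))^2}{1-\lambda_2^2}+\tfrac{2a_{12}a_{21}b_2^2-2a_{21}^2b_1^2-2a_{21}b_1b_2(a_{22}-a_{11})}{1-\lambda_1\lambda_2},$$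 $$\Sigma_{12}=\Sigma_{21}=\tfrac{a_{21}(a_{11}-\lambda_2)b_1^2+a_{12}(\lambda_1-a_{11})b_2^2+2a_{12}a_{21}b_1b_2}{1-\lambda_1^2}+\tfrac{a_{21}(a_{11}-\lambda_1)b_1^2+a_{12}(\lambda_2-a_{11})b_2^2+2a_{12}a_{21}b_1b_2}{1-\lambda_2^2}+\tfrac{(a_{22}-a_{11})(a_{21}b_1^2-a_{12}b_2^2+b_1b_2(a_{22}-a_{11}))}{1-\lambda_1\lambda_2}.$$ LDP: a rate function is a lower semicontinuous map $\mathbb R^2\to[0,\infty]$; it is good if all level sets $\{I\le a\}$, $a\in[0,\infty)$, are compact. A family $\{\mu_\epsilon\}_{\epsilon>0}$ of Borel probability measures satisfies the LDP with rate function $I$ if $\liminf_{\epsilon\to0}\epsilon\ln\mu_\epsilon(U)\ge-\inf_U I$ for all open $U$ and $\limsup_{\epsilon\to0}\epsilon\ln\mu_\epsilon(C)\le-\inf_C I$ for all closed $C$. Asymptotic preservation: $\mu_{\nu,\epsilon}$ denotes the unique invariant measure of the Langevin equation, $d\mu_{\nu,\epsilon}\propto\exp\{-\frac{\nu}{\epsilon}(p^2+q^2)\}dp\,dq$; the family $\{\mu_{\nu,\epsilon}\}_{\epsilon>0}$ satisfies the LDP with rate function $\nu(p^2+q^2)$. The method is said to asymptotically preserve the LDP of $\{\mu_{\nu,\epsilon}\}_{\epsilon>0}$ if there is $h_0>0$ such that for every $h\le h_0$ it has a unique invariant measure $\mu^h_{\nu,\epsilon}$ for all sufficiently small $\epsilon>0$,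 the family $\{\mu^h_{\nu,\epsilon}\}_{\epsilon>0}$ satisfies the LDP with a rate function $I^h$, and $\lim_{h\to0}I^h(p,q)=\nu(p^2+q^2)$ for all $(p,q)\in\mathbb R^2$. *)

(* Defs.v *)
From HB Require Import structures.
From mathcomp Require Import all_boot all_order all_algebra.
From mathcomp Require Import all_classical all_reals all_analysis.
From mathcomp Require Import complex.

Set Implicit Arguments.
Unset Strict Implicit.
Unset Printing Implicit Defensive.

Import Order.TTheory GRing.Theory Num.Theory.
Import numFieldNormedType.Exports.

Local Open Scope classical_set_scope.
Local Open Scope ring_scope.

Section wiener.
Context {R : realType} d {T : measurableType d} (P : probability T R).

Definition mutually_independent (X : nat -> T -> R) (n : nat) : Prop :=
  forall B : nat -> set R, (forall i, measurable (B i)) ->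
    P (\bigcap_(i < n) (X i @^-1` B i)) =
    (\prod_(i < n) P (X i @^-1` B i))%E.

(* Only the values [W t] with [0 <= t] are meaningful.  The second parameter of
   [normal_prob] is the standard deviation. *)
Record standard_wiener (W : R -> T -> R) : Prop := {
  wiener_measurable : forall t, 0 <= t -> measurable_fun setT (W t) ;
  wiener_start : {ae P, forall w, W 0 w = 0} ;
  wiener_gaussian : forall s t, 0 <= s -> s < t ->
    forall B : set R, measurable B ->
      P ((W t \- W s) @^-1` B) = normal_prob 0 (Num.sqrt (t - s)) B ;
  wiener_independent : forall (t : nat -> R) (n : nat),
    (forall i, 0 <= t i) -> {homo t : i j / (i <= j)%N >-> i <= j} ->
    mutually_independent (fun i => W (t i.+1) \- W (t i)) n ;
  wiener_continuous :
    {ae P, forall w, {within `[0, +oo[, continuous (fun t => W t w)}} }.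

End wiener.

Section numerical_method.
Context {R : realType} d {T : measurableType d} (P : probability T R).
Variables (W : R -> T -> R) (A : 'M[R]_2) (b : 'cV[R]_2) (h eps : R).

(* The pair [(P_n, Q_n)] started at the deterministic point [x]; [R * R] rather
   than ['cV[R]_2] because the product carries the Borel sigma-algebra. *)
Fixpoint chain (x : R * R) (n : nat) (w : T) : R * R :=
  if n is m.+1 then
    let: (p, q) := chain x m w in
    let dW := W (m.+1%:R * h) w - W (m%:R * h) w in
    (A 0 0 * p + A 0 1 * q + Num.sqrt eps * b 0 0 * dW,
     A 1 0 * p + A 1 1 * q + Num.sqrt eps * b 1 0 * dW)
  else x.

Definition invariant_measure (mu : probability (R * R)%type R) : Prop :=
  forall (phi : R * R -> R) (n : nat), continuous phi -> bounded_fun phi ->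
    (\int[mu]_x 'E_P[fun w => phi (chain x n w)] = \int[mu]_x (phi x)%:E)%E.

(* Uniqueness is equality on Borel sets: the values of a library measure outside
   its sigma-algebra are irrelevant. *)
Definition unique_invariant_measure (mu : probability (R * R)%type R) : Prop :=
  invariant_measure mu /\
  forall mu' : probability (R * R)%type R, invariant_measure mu' ->
    forall B : set (R * R), measurable B -> mu' B = mu B.

End numerical_method.

Section large_deviations.
Context {R : realType}.
Implicit Type I : R * R -> \bar R.

Definition rate_function I : Prop :=
  lower_semicontinuous I /\ forall x, (0 <= I x)%E.

Definition good_rate_function I : Prop :=
  rate_function I /\
  forall a : R, 0 <= a -> compact [set x | (I x <= a%:E)%E].

(* [mu eps] is relevant for [0 < eps] only; [lne 0 = -oo], whereas [ln 0 = 0]. *)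
Definition LDP (mu : R -> probability (R * R)%type R) I : Prop :=
  [/\ rate_function I,
      forall U : set (R * R), open U ->
        (limf_einf (fun eps : R => eps%:E * lne (mu eps U)) 0^'+ >=
           - ereal_inf [set I x | x in U])%E
    & forall C : set (R * R), closed C ->
        (limf_esup (fun eps : R => eps%:E * lne (mu eps C)) 0^'+ <=
           - ereal_inf [set I x | x in C])%E].

End large_deviations.

Section rate_function_formula.
Context {R : realType}.
Local Open Scope complex_scope.
Variables (A : 'M[R]_2) (b : 'cV[R]_2) (h : R).

Let a11 : R[i] := (A 0 0)%:C.
Let a12 : R[i] := (A 0 1)%:C.
Let a21 : R[i] := (A 1 0)%:C.
Let a22 : R[i] := (A 1 1)%:C.
Let b1 : R[i] := (b 0 0)%:C.
Let b2 : R[i] := (b 1 0)%:C.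

Definition discr : R := (\tr A) ^+ 2 - 4 * \det A.

Definition lambda1 : R[i] := ((\tr A)%:C + sqrtc discr%:C) / 2.
Definition lambda2 : R[i] := ((\tr A)%:C - sqrtc discr%:C) / 2.

Definition Sigma11 : R[i] :=
  (a12 * b2 + b1 * (a11 - lambda2)) ^+ 2 / (1 - lambda1 ^+ 2)
  + (a12 * b2 + b1 * (a11 - lambda1)) ^+ 2 / (1 - lambda2 ^+ 2)
  + (2 * a12 * a21 * b1 ^+ 2 - 2 * a12 ^+ 2 * b2 ^+ 2
     + 2 * a12 * b1 * b2 * (a22 - a11)) / (1 - lambda1 * lambda2).

Definition Sigma22 : R[i] :=
  (a21 * b1 + b2 * (lambda1 - a11)) ^+ 2 / (1 - lambda1 ^+ 2)
  + (a21 * b1 + b2 * (lambda2 - a11)) ^+ 2 / (1 - lambda2 ^+ 2)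
  + (2 * a12 * a21 * b2 ^+ 2 - 2 * a21 ^+ 2 * b1 ^+ 2
     - 2 * a21 * b1 * b2 * (a22 - a11)) / (1 - lambda1 * lambda2).

Definition Sigma12 : R[i] :=
  (a21 * (a11 - lambda2) * b1 ^+ 2 + a12 * (lambda1 - a11) * b2 ^+ 2
   + 2 * a12 * a21 * b1 * b2) / (1 - lambda1 ^+ 2)
  + (a21 * (a11 - lambda1) * b1 ^+ 2 + a12 * (lambda2 - a11) * b2 ^+ 2
     + 2 * a12 * a21 * b1 * b2) / (1 - lambda2 ^+ 2)
  + ((a22 - a11) * (a21 * b1 ^+ 2 - a12 * b2 ^+ 2 + b1 * b2 * (a22 - a11)))
    / (1 - lambda1 * lambda2).

Definition rate_formula (x : R * R) : R[i] :=
  let p := x.1%:C in let q := x.2%:C in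
  discr%:C * (Sigma22 * p ^+ 2 + Sigma11 * q ^+ 2 - 2 * Sigma12 * p * q)
  / (2 * h%:C * (Sigma11 * Sigma22 - Sigma12 ^+ 2)).

(* [lambda1] and [lambda2] may be non-real, so the formula is evaluated in
   [R[i]]; its value is real when [lambda1] and [lambda2] are complex
   conjugates as well as when both are real. *)
Definition Ih (x : R * R) : R := complex.Re (rate_formula x).

End rate_function_formula.

Section asymptotic_preservation.
Context {R : realType} d {T : measurableType d} (P : probability T R).

(* Rate function of the invariant measures of the Langevin equation, with
   density proportional to [exp (- nu / eps * (p ^ 2 + q ^ 2))]. *)
Definition langevin_rate (nu : R) (x : R * R) : R :=
  nu * (x.1 ^+ 2 + x.2 ^+ 2).

Definition asymptotically_preserves (W : R -> T -> R)
    (A : R -> 'M[R]_2) (b : R -> 'cV[R]_2) (nu : R)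
    (I : R -> R * R -> \bar R) : Prop :=
  (exists2 h0 : R, 0 < h0 &
    forall h, 0 < h -> h <= h0 ->
      exists2 mu : R -> probability (R * R)%type R,
        (\forall eps \near 0^'+,
           unique_invariant_measure P W (A h) (b h) h eps (mu eps)) &
        LDP mu (I h)) /\
  forall x, I h x @[h --> 0^'+] --> (langevin_rate nu x)%:E.

End asymptotic_preservation.

(* Main.v *)
Require Import Defs.
From HB Require Import structures.
From mathcomp Require Import all_boot all_order all_algebra.
From mathcomp Require Import all_classical all_reals all_analysis.
From mathcomp Require Import complex ring lra measurable_realfun.

Set Implicit Arguments.
Unset Strict Implicit.
Unset Printing Implicit Defensive.

Import Order.TTheory GRing.Theory Num.Theory.
Import numFieldNormedType.Exports.

Local Open Scope classical_set_scope.
Local Open Scope ring_scope.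

(** In law, one step of the scheme is [x |-> A x + sqrt (eps h) b z] with [z] a
    standard Gaussian variable independent of [x].  A centred Gaussian law of
    covariance [eps h S] is invariant as soon as [S = A S A^T + b b^T], and the
    solution of this Lyapunov equation is the sum over [n] of the matrices
    [A ^ n b b^T (A^T) ^ n].  By Cayley-Hamilton the coordinates of [A ^ n b] solve
    a linear recurrence of order two, so [S] is a rational function of the entries
    of [A] and [b] ([recurrence_gram], [recurrence_gram_lyapunov]).

    Existence of the invariant law.  The Gaussian law is the image of the standard
    one by a Cholesky factor [L] of [eps h S].  In the coordinates given by [L] the
    step has a [2 x 3] matrix, and the Lyapunov equation says that its rows are
    orthonormal, hence the step preserves the standard Gaussian law
    ([gauss2_orthonormal], [gaussian_law_step]).  Invariance after [n] steps then
    follows by independence of the increments of [W] ([recursion_stationary]).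

    Uniqueness.  Two trajectories driven by the same noise differ by
    [A ^ n (x - y)], which tends to 0 because for small [h] the scheme inherits a
    quadratic Lyapunov function of the damped oscillator
    ([consistent_scheme_contracts]).  Thus the expectation of a Lipschitz function
    after [n] steps has a limit that does not depend on the starting point, and this
    limit is its integral against every invariant measure
    ([coupled_invariant_unique]).

    Large deviations.  The invariant law is that of [sqrt eps] times a fixed
    Gaussian vector, so the rate function is half of the squared norm of the
    preimage by the Cholesky factor of [h S]: the upper bound is a Chernoff bound,
    the lower bound is the mass of a small box ([gaussian_law_LDP]).

    The formula.  Diagonalising [A] over the complex numbers in the same sum gives
    the displayed entries of [Sigma], up to the factor [discr A] that comes from the
    eigenvectors: [Sigma = discr A * S] ([Sigma11E], [Sigma12E], [Sigma22E]).  As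
    [discr (A h)] is [h ^ 2 (nu ^ 2 - 4)] to leading order, it is nonzero for small
    [h] when [nu != 2]; it then cancels, and [Ih] is the quadratic form of
    [(h S)^-1 / 2] ([rate_formulaE], [Ih_gaussian_rate]).  Finally [h S] tends to the
    identity divided by [2 nu] ([lyapunov_cvg]), which gives the limit
    [nu (p ^ 2 + q ^ 2)]. *)

(** * Affine substitutions in the line and the plane *)

Section affine_substitution.
Context {R : realType}.
Local Notation leb := (@lebesgue_measure R).

Lemma lebesgue_measure_affine (a c : R) (A : set R) : a != 0 -> measurable A ->
  leb A = (`|a|%:E * leb (((fun x : R => a * x + c)%R) @^-1` A))%E.
Proof.
move=> a0 mA.
have mphi : measurable_fun [set: R] (fun x : R => a * x + c).
  by apply: measurable_funD => //; exact: measurable_funM.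
pose phi : {mfun measurableTypeR R >-> measurableTypeR R} :=
  @mfun_Sub _ _ (measurableTypeR R) (measurableTypeR R)
    (fun x : R => a * x + c) (mem_set mphi).
pose k := NngNum (normr_ge0 a).
rewrite [LHS](@lebesgue_measure_unique _ (mscale k (pushforward leb phi))) //.
move=> _ [[u v] _ <-].
transitivity (`|a|%:E * leb (phi @^-1` `]u, v]))%E; last by [].
have h : phi @^-1` `]u, v] =
    if 0 < a then `](u - c) / a, (v - c) / a]%classic
    else `[(v - c) / a, (u - c) / a[%classic.
  apply/seteqP; case: ifPn => ha; split => x /=; rewrite !in_itv/=.
  - by move=> /andP[h1 h2]; rewrite ltr_pdivrMr// ler_pdivlMr// mulrC
      ltrBlDr h1 lerBrDr h2.
  - by rewrite ltr_pdivrMr// ler_pdivlMr// mulrC ltrBlDr lerBrDr.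
  - have {}ha : a < 0 by rewrite lt_neqAle a0 leNgt.
    by rewrite ler_ndivrMr// ltr_ndivlMr// mulrC ltrBlDr lerBrDr andbC.
  - have {}ha : a < 0 by rewrite lt_neqAle a0 leNgt.
    by rewrite ler_ndivrMr// ltr_ndivlMr// mulrC ltrBlDr lerBrDr andbC.
rewrite h; case: ifPn => ha; rewrite !lebesgue_measure_itv/= !lte_fin.
- rewrite ltr_pM2r ?invr_gt0// ltrD2r; case: ifPn => _; last by rewrite mule0.
  rewrite -!EFinB -EFinM gtr0_norm//; congr EFin; by field.
- have {}ha : a < 0 by rewrite lt_neqAle a0 leNgt.
  rewrite ltr_nM2r ?invr_lt0// ltrD2r; case: ifPn => _; last by rewrite mule0.
  rewrite -!EFinB -EFinM ltr0_norm//; congr EFin; by field.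
Qed.

Lemma ge0_integral_affine (a c : R) (f : R -> \bar R) : a != 0 ->
  measurable_fun setT f -> (forall x, (0 <= f x)%E) ->
  (\int[leb]_x f x = `|a|%:E * \int[leb]_x f (a * x + c)%R)%E.
Proof.
move=> a0 mf f0.
have mphi : measurable_fun [set: R] (fun x : R => a * x + c).
  by apply: measurable_funD => //; exact: measurable_funM.
pose phi : {mfun measurableTypeR R >-> measurableTypeR R} :=
  @mfun_Sub _ _ (measurableTypeR R) (measurableTypeR R)
    (fun x : R => a * x + c) (mem_set mphi).
pose k := NngNum (normr_ge0 a).
have [m mE] : exists m : {measure set (measurableTypeR R) -> \bar R},
    m = pushforward leb phi :> (set _ -> _).
  by unshelve eexists (pushforward leb phi : {measure set _ -> \bar R}).
transitivity (\int[mscale k m]_x f x)%E.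
  apply: eq_measure_integral => A mA _.
  rewrite [LHS](@lebesgue_measure_affine a c)//.
  by transitivity (`|a|%:E * m A)%E; [rewrite mE|].
by rewrite ge0_integral_mscale//= mE ge0_integral_pushforward.
Qed.

End affine_substitution.

Section density.
Local Open Scope ereal_scope.
Context d (T : measurableType d) {R : realType}.
Variables (mu nu : {measure set T -> \bar R}) (g : T -> R).
Hypotheses (mg : measurable_fun setT g) (g0 : forall x, (0 <= g x)%R).
Hypothesis nuE : forall A, measurable A -> nu A = \int[mu]_(x in A) (g x)%:E.

Import HBNNSimple.

Let nnsfun_integral_density (f : {nnsfun T >-> R}) :
  \int[nu]_x (f x)%:E = \int[mu]_x ((f x)%:E * (g x)%:E).
Proof.
under eq_integral do rewrite fimfunE -fsumEFin//.
rewrite ge0_integral_fsum//; last 2 first.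
- by move=> r; exact/measurable_EFinP/measurable_funM.
- by move=> r t _; rewrite EFinM nnfun_muleindic_ge0.
have fgE t : (f t)%:E * (g t)%:E = \sum_(r \in range f)
    ((r * \1_(f @^-1` [set r]) t)%:E * (g t)%:E).
  rewrite fimfunE -fsumEFin// ge0_mule_fsuml// => r.
  by rewrite EFinM; exact: nnfun_muleindic_ge0.
under [RHS]eq_integral do rewrite fgE.
rewrite ge0_integral_fsum//; last 2 first.
- move=> r; apply: emeasurable_funM; last exact/measurable_EFinP.
  exact/measurable_EFinP/measurable_funM.
- move=> r t _; apply: mule_ge0; last by rewrite lee_fin.
  by rewrite EFinM; exact: nnfun_muleindic_ge0.
apply: eq_fsbigr => r _.
have [r0|r0] := leP 0%R r; last first.
  rewrite !integral0_eq// => t _; rewrite preimage_nnfun0// indic0.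
    by rewrite mulr0 mul0e.
  by rewrite mulr0.
under eq_integral do rewrite EFinM.
rewrite ge0_integralZl//; last exact/measurable_EFinP.
under [RHS]eq_integral do rewrite EFinM -muleA.
rewrite ge0_integralZl//; last 2 first.
- by apply: emeasurable_funM; exact/measurable_EFinP.
- by move=> t _; rewrite mule_ge0 ?lee_fin.
congr (_ * _); rewrite integral_indic// setIT nuE//.
rewrite integral_mkcond; apply: eq_integral => t _.
rewrite patchE indicE; case: (t \in _); by rewrite ?mul1e ?mul0e.
Qed.

Lemma ge0_integral_density (f : T -> \bar R) :
  measurable_fun setT f -> (forall x, 0 <= f x) ->
  \int[nu]_x f x = \int[mu]_x (f x * (g x)%:E).
Proof.
move=> mf f0; pose f_ := nnsfun_approx measurableT mf.
have f_f x : EFin \o f_ ^~ x @ \oo --> f x by exact: cvg_nnsfun_approx.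
transitivity (limn (fun n => \int[nu]_x (f_ n x)%:E)).
  rewrite -monotone_convergence//.
  - by apply: eq_integral => x _; apply/esym/cvg_lim => //; exact: f_f.
  - by move=> n; exact/measurable_EFinP.
  - by move=> n x _; rewrite lee_fin.
  - by move=> x _ m n mn; rewrite lee_fin; exact/lefP/nd_nnsfun_approx.
transitivity (limn (fun n => \int[mu]_x ((f_ n x)%:E * (g x)%:E))).
  by congr (limn _); apply/funext => n; exact: nnsfun_integral_density.
rewrite -monotone_convergence//.
- apply: eq_integral => x _; apply/cvg_lim => //.
  by apply: cvgeZr => //; exact: f_f.
- by move=> n; apply: emeasurable_funM; exact/measurable_EFinP.
- by move=> n x _; rewrite mule_ge0 ?lee_fin.
- move=> x _ m n mn; rewrite lee_pmul ?lee_fin//.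
  exact/lefP/nd_nnsfun_approx.
Qed.

End density.

Section planar_substitution.
Local Open Scope ereal_scope.
Context {R : realType}.
Local Notation leb := (@lebesgue_measure R).

(** Two substitutions in the line suffice: the first coordinate is substituted with
    the second one fixed, then the second with the first fixed.  The first
    one needs [a * x.1 + b * x.2 + e] in terms of [x.1] and of the second coordinate
    of the image, hence divides by [d]. *)
Lemma ge0_integral_planar (a b c d e f : R) (F : R * R -> \bar R) :
    d != 0%R -> (a * d - b * c)%R != 0%R ->
    measurable_fun setT F -> (forall x, 0 <= F x) ->
  \int[leb \x leb]_x F x = `|a * d - b * c|%:E *
    \int[leb \x leb]_x F (a * x.1 + b * x.2 + e, c * x.1 + d * x.2 + f)%R.
Proof.
move=> d0 D0 mF F0; set D := (a * d - b * c)%R.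
have maff (s t r : R) : measurable_fun setT (fun x : R * R => s * x.1 + t * x.2 + r)%R.
  by apply: measurable_funD => //; apply: measurable_funD; exact: measurable_funM.
have mcomp (g1 g2 : R * R -> R) : measurable_fun setT g1 ->
    measurable_fun setT g2 -> measurable_fun setT (fun x => F (g1 x, g2 x)).
  move=> m1 m2; apply: (measurableT_comp mF).
  exact/measurable_fun_pairP.
rewrite (@fubini_tonelli2 _ _ (measurableTypeR R) (measurableTypeR R) _ leb leb)//.
have mF1 y : measurable_fun setT (fun x => F (x, y)).
  exact: measurableT_comp.
under eq_integral => y _.
  rewrite /fubini_G (@ge0_integral_affine _ (D / d) (b / d * (y - f) + e))//; last first.
    by rewrite mulf_neq0// invr_neq0.
  over.
have mFa : measurable_fun setT
    (fun z : R * R => F ((D / d) * z.1 + (b / d * (z.2 - f) + e), z.2)%R).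
  apply: mcomp => //.
  rewrite (_ : (fun _ => _) = fun x => (D / d) * x.1 + (b / d) * x.2 + (e - b / d * f))%R//.
  by apply/funext => x; ring.
rewrite ge0_integralZl//; last 2 first.
- by have := @measurable_fun_fubini_tonelli_G _ _ (measurableTypeR R) (measurableTypeR R) _ leb _ mFa; apply => z; exact: F0.
- by move=> y _; exact: integral_ge0.
rewrite -(@fubini_tonelli _ _ (measurableTypeR R) (measurableTypeR R) _ leb leb _ mFa)//.
under [X in _ * X]eq_integral => u _.
  rewrite (@ge0_integral_affine _ d (c * u + f))//=; last first.
    exact: (measurableT_comp mFa (pair1_measurable u)).
  over.
rewrite ge0_integralZl//; last 2 first.
- have mFb : measurable_fun setT
    (fun z : R * R => F ((D / d) * z.1 + (b / d * (d * z.2 + (c * z.1 + f) - f) + e), d * z.2 + (c * z.1 + f))%R).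
    apply: mcomp.
    + rewrite (_ : (fun _ => _) = fun x => a * x.1 + b * x.2 + e)%R//.
      by apply/funext => x; rewrite /D; field.
    + rewrite (_ : (fun _ => _) = fun x => c * x.1 + d * x.2 + f)%R//.
      by apply/funext => x; ring.
  by have := @measurable_fun_fubini_tonelli_F _ _ (measurableTypeR R) (measurableTypeR R) _ leb _ mFb; apply => z; exact: F0.
- by move=> y _; exact: integral_ge0.
rewrite muleA -EFinM -normrM divfK//; congr (_ * _).
have mFc : measurable_fun setT
    (fun x => F (a * x.1 + b * x.2 + e, c * x.1 + d * x.2 + f)%R) by exact: mcomp.
rewrite (@fubini_tonelli1 _ _ (measurableTypeR R) (measurableTypeR R) _ leb leb _ mFc); last first.
  by move=> x; exact: F0.
apply: eq_integral => u _; apply: eq_integral => v _; congr (F (_, _)) => /=.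
  by rewrite /D; field.
by ring.
Qed.

End planar_substitution.

(** * The standard Gaussian law of the plane *)

Section orthonormal_completion.
Context {F : fieldType}.

(** Two orthonormal rows of length 3, completed by their cross product, form an
    orthogonal matrix, so its columns are orthonormal as well. *)
Lemma orthonormal_columns (a b c d e f : F) :
  a ^+ 2 + b ^+ 2 + c ^+ 2 = 1 -> d ^+ 2 + e ^+ 2 + f ^+ 2 = 1 ->
  a * d + b * e + c * f = 0 ->
  let x := b * f - c * e in let y := c * d - a * f in let z := a * e - b * d in
  [/\ a ^+ 2 + d ^+ 2 + x ^+ 2 = 1, b ^+ 2 + e ^+ 2 + y ^+ 2 = 1
    & c ^+ 2 + f ^+ 2 + z ^+ 2 = 1] /\
  [/\ a * b + d * e + x * y = 0, a * c + d * f + x * z = 0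
    & b * c + e * f + y * z = 0].
Proof.
move=> h11 h22 h12 x y z.
have h33 : x ^+ 2 + y ^+ 2 + z ^+ 2 = 1.
  transitivity ((a ^+ 2 + b ^+ 2 + c ^+ 2) * (d ^+ 2 + e ^+ 2 + f ^+ 2)
    - (a * d + b * e + c * f) ^+ 2); first by rewrite /x /y /z; ring.
  by rewrite h11 h22 h12; ring.
pose rows := [:: [:: a; b; c]; [:: d; e; f]; [:: x; y; z]].
pose U : 'M[F]_3 := \matrix_(i, j) nth 0 (nth [::] rows i) j.
have UUt : U *m U^T = 1%:M.
  apply/matrixP => i j; rewrite !mxE !big_ord_recl big_ord0 /= !mxE.
  have expand2 (p q r : F) : p * p + (q * q + (r * r + 0)) = p ^+ 2 + q ^+ 2 + r ^+ 2.
    by ring.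
  case: i => [[|[|[|//]]] hi]; case: j => [[|[|[|//]]] hj];
    rewrite /= ?expand2 ?h11 ?h22 ?h33 //=.
  - by rewrite addr0 addrA.
  - by rewrite /x /y /z; ring.
  - by rewrite addr0 addrA !(mulrC d) !(mulrC e) !(mulrC f).
  - by rewrite /x /y /z; ring.
  - by rewrite /x /y /z; ring.
  - by rewrite /x /y /z; ring.
have /mulmx1C UtU := UUt.
have entry (i j : 'I_3) : (U^T *m U) i j = (i == j)%:R by rewrite UtU mxE.
pose i0 := @Ordinal 3 0 isT; pose i1 := @Ordinal 3 1 isT; pose i2 := @Ordinal 3 2 isT.
have := entry i0 i0; have := entry i1 i1; have := entry i2 i2.
have := entry i0 i1; have := entry i0 i2; have := entry i1 i2.
rewrite !mxE !big_ord_recl !big_ord0 /= !mxE /= => h1 h2 h3 h4 h5 h6.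
split; split.
- by apply: etrans h6; ring.
- by apply: etrans h5; ring.
- by apply: etrans h4; ring.
- by apply: etrans h3; ring.
- by apply: etrans h2; ring.
- by apply: etrans h1; ring.
Qed.

End orthonormal_completion.

Section standard_gaussian.
Context {R : realType}.
Local Notation leb := (@lebesgue_measure R).
Local Notation k := (normal_pdf (0 : R) 1).

(** [normal_prob] lives on the generated sigma-algebra type [measurableTypeR R];
    pushing it forward along the identity moves it to [R] itself. *)
Let measurable_id_R : measurable_fun setT (fun x : measurableTypeR R => (x : R)).
Proof. by []. Qed.

Definition measurableTypeR_id : {mfun measurableTypeR R >-> R} :=
  mfun_Sub (mem_set measurable_id_R).

Definition gauss : probability R R :=
  distribution (normal_prob 0 1) measurableTypeR_id.

Definition gauss2 : probability (R * R)%type R := (gauss \x gauss)%E.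

Local Open Scope ereal_scope.

Lemma ge0_integral_gauss (f : R -> \bar R) :
  measurable_fun setT f -> (forall x, 0 <= f x) ->
  \int[gauss]_x f x = \int[leb]_x (f x * (k x)%:E).
Proof.
move=> mf f0; rewrite ge0_integral_distribution//.
apply: (@ge0_integral_density _ _ _ leb (normal_prob 0 1) k) => //.
- exact: measurable_normal_pdf.
- exact: normal_pdf_ge0.
Qed.

Lemma ge0_integral_gauss2 (f : R * R -> \bar R) :
  measurable_fun setT f -> (forall x, 0 <= f x) ->
  \int[gauss2]_x f x = \int[leb \x leb]_x (f x * (k x.1 * k x.2)%:E).
Proof.
move=> mf f0; rewrite (fubini_tonelli1 (m1 := gauss) (m2 := gauss))//.
have mk (g : R * R -> R) : measurable_fun setT g -> measurable_fun setT (k \o g).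
  by move=> mg; apply: measurableT_comp mg; exact: measurable_normal_pdf.
have mfk : measurable_fun setT (fun x => f x * (k x.1 * k x.2)%:E).
  apply: emeasurable_funM => //; apply/measurable_EFinP.
  by apply: measurable_funM; exact: mk.
rewrite (@fubini_tonelli1 _ _ (measurableTypeR R) (measurableTypeR R) _ leb leb _ mfk); last first.
  by move=> x; rewrite mule_ge0// lee_fin mulr_ge0 ?normal_pdf_ge0.
rewrite ge0_integral_gauss//; last 2 first.
- exact: measurable_fun_fubini_tonelli_F.
- by move=> x; exact: integral_ge0.
apply: eq_integral => u _; rewrite /fubini_F ge0_integral_gauss//; last first.
  exact: measurableT_comp.
rewrite -ge0_integralZr//=.
- by apply: eq_integral => v _; rewrite EFinM -muleA; congr (_ * _); rewrite muleC.
- apply: emeasurable_funM; first exact: measurableT_comp.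
  by apply/measurable_EFinP; exact: measurable_normal_pdf.
- by move=> v _; rewrite mule_ge0// lee_fin normal_pdf_ge0.
- by rewrite lee_fin normal_pdf_ge0.
Qed.

Lemma normal_peak_scale (s : R) : s != 0%R ->
  (`|s| * normal_peak s = normal_peak 1)%R.
Proof.
move=> s0; rewrite /normal_peak -mulrnAr sqrtrM ?sqr_ge0// sqrtr_sqr.
by rewrite expr1n mul1r invfM mulrA divff ?mul1r// normr_eq0.
Qed.

(** The change of variables [y = N p + z b] turns the product of the densities of
    [N(0, 1)^2] at [y] and of [N(b.y, (det N)^2)] at [z] into that of [N(0, 1)^3]
    at [(p, z)], because the quadratic forms in the exponents agree. *)
Lemma gauss2_density_orthonormal (a b c d e f u v z : R) :
  (a ^+ 2 + b ^+ 2 + c ^+ 2 = 1 -> d ^+ 2 + e ^+ 2 + f ^+ 2 = 1 ->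
  a * d + b * e + c * f = 0 -> a * e - b * d != 0 ->
  let y1 := a * u + b * v + c * z in let y2 := d * u + e * v + f * z in
  `|a * e - b * d| * (k y1 * k y2 *
    normal_pdf (c * y1 + f * y2) (a * e - b * d) z) = k u * k v * k z)%R.
Proof.
move=> h11 h22 h12 D0 y1 y2; rewrite !normal_pdfE ?oner_eq0//.
rewrite -(normal_peak_scale D0) /normal_fun.
set D := (a * e - b * d)%R in D0 *.
set P := normal_peak D.
transitivity (`|D| * (`|D| * P) * (`|D| * P) * P * (expR (- (y1 - 0) ^+ 2 / (1 ^+ 2 *+ 2))
  * expR (- (y2 - 0) ^+ 2 / (1 ^+ 2 *+ 2)) *
  expR (- (z - (c * y1 + f * y2)) ^+ 2 / (D ^+ 2 *+ 2))))%R; first by ring.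
rewrite -!expRD.
transitivity (`|D| * (`|D| * P) * (`|D| * P) * P * (expR (- (u - 0) ^+ 2 / (1 ^+ 2 *+ 2))
  * expR (- (v - 0) ^+ 2 / (1 ^+ 2 *+ 2)) *
  expR (- (z - 0) ^+ 2 / (1 ^+ 2 *+ 2))))%R; last by ring.
rewrite -!expRD; congr (_ * expR _)%R.
have [[]] := orthonormal_columns h11 h22 h12.
rewrite -/D; set x1 := (b * f - c * e)%R; set x2 := (c * d - a * f)%R.
move=> E11 E22 E33 [E12 E13 E23].
have -> : (z - (c * y1 + f * y2) = D * (x1 * u + x2 * v + D * z))%R.
  transitivity (z - (a * c + d * f + x1 * D) * u - (b * c + e * f + x2 * D) * v
     - (c ^+ 2 + f ^+ 2 + D ^+ 2) * z + D * (x1 * u + x2 * v + D * z))%R.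
    by rewrite /y1 /y2; ring.
  by rewrite E13 E23 E33; ring.
have -> : (- (D * (x1 * u + x2 * v + D * z)) ^+ 2 / (D ^+ 2 *+ 2)
  = - (x1 * u + x2 * v + D * z) ^+ 2 / 2)%R by field.
transitivity (- ((a ^+ 2 + d ^+ 2 + x1 ^+ 2) * u ^+ 2
   + (b ^+ 2 + e ^+ 2 + x2 ^+ 2) * v ^+ 2 + (c ^+ 2 + f ^+ 2 + D ^+ 2) * z ^+ 2
   + 2 * (a * b + d * e + x1 * x2) * (u * v) + 2 * (a * c + d * f + x1 * D) * (u * z)
   + 2 * (b * c + e * f + x2 * D) * (v * z)) / 2)%R.
  by rewrite /y1 /y2; field.
by rewrite E11 E22 E33 E12 E13 E23; field.
Qed.

End standard_gaussian.

Section standard_gaussian_invariance.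
Context {R : realType}.
Local Notation leb := (@lebesgue_measure R).
Local Notation k := (normal_pdf (0 : R) 1).
Local Open Scope ereal_scope.

(** Orthogonal maps preserve the standard Gaussian law of [R ^ 3], and the law of
    any two coordinates is standard; so [N p + z b] is standard Gaussian as soon
    as the rows of [(N | b)] are orthonormal.  The third coordinate of the
    orthogonal map appears as an auxiliary variable of density [g], conditionally
    Gaussian given the first two; integrating it out gives the left-hand side, and
    the change of variables with that coordinate fixed gives the right-hand side. *)
Lemma gauss2_orthonormal (a b c d e f : R) (F : R * R -> \bar R) :
  (a ^+ 2 + b ^+ 2 + c ^+ 2 = 1)%R -> (d ^+ 2 + e ^+ 2 + f ^+ 2 = 1)%R ->
  (a * d + b * e + c * f = 0)%R -> (a * e - b * d != 0)%R -> (e != 0)%R ->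
  measurable_fun setT F -> (forall x, 0 <= F x) ->
  \int[gauss2]_x F x = \int[gauss]_z \int[gauss2]_p
    F (a * p.1 + b * p.2 + c * z, d * p.1 + e * p.2 + f * z)%R.
Proof.
move=> h11 h22 h12 D0 e0 mF F0.
set D := (a * e - b * d)%R in D0.
pose g (x : R * R * R) := normal_pdf (c * x.1.1 + f * x.1.2) D x.2.
have g0 x : (0 <= g x)%R by exact: normal_pdf_ge0.
have mg : measurable_fun setT g.
  rewrite /g /normal_pdf (negbTE D0); apply: measurable_funM => //.
  apply: measurableT_comp => //; apply: measurable_funM => //.
  apply: measurableT_comp => //; apply: measurable_funX.
  apply: measurable_funB => //; apply: measurable_funD; apply: measurable_funM => //;
    exact: measurableT_comp.
have mk d' (S : measurableType d') (h : S -> R) :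
    measurable_fun setT h -> measurable_fun setT (k \o h).
  by move=> mh; apply: measurableT_comp mh; exact: measurable_normal_pdf.
have mkk : measurable_fun setT (fun x : R * R => (k x.1 * k x.2)%:E).
  by apply/measurable_EFinP/measurable_funM; exact: mk.
pose G (x : R * R * R) := F x.1 * (g x)%:E.
have mG : measurable_fun setT G.
  by apply: emeasurable_funM; [exact: measurableT_comp|exact/measurable_EFinP].
have G0 x : 0 <= G x by rewrite mule_ge0// lee_fin.
pose N z (p : R * R) := (a * p.1 + b * p.2 + c * z, d * p.1 + e * p.2 + f * z)%R.
have mN : measurable_fun setT (fun x : R * (R * R) => N x.1 x.2).
  apply/measurable_fun_pairP; split; apply: measurable_funD;
    (try by apply: measurable_funM); apply: measurable_funD; apply: measurable_funM => //;
    exact: measurableT_comp.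
have mFN : measurable_fun setT (fun x : R * (R * R) => F (N x.1 x.2)).
  exact: (measurableT_comp mF mN).
transitivity (\int[gauss2]_y \int[leb]_z G (y, z)).
  apply: eq_integral => y _; rewrite /G/= ge0_integralZl//.
  - rewrite -[LHS]mule1; congr (_ * _); apply/esym.
    exact: (integral_normal_pdf (c * y.1 + f * y.2)%R D).
  - by apply/measurable_EFinP; exact: (measurableT_comp mg (pair1_measurable y)).
  - by move=> z _; rewrite lee_fin; exact: (g0 (y, z)).
rewrite (@fubini_tonelli _ _ _ (measurableTypeR R) _ gauss2 leb _ mG)//.
rewrite ge0_integral_gauss; last 2 first.
- exact: (measurable_fun_fubini_tonelli_F _ mFN).
- by move=> z; exact: integral_ge0.
apply: eq_integral => z _.
have mGz : measurable_fun setT (fun y => G (y, z)).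
  exact: (measurableT_comp mG (measurable_pair2 z)).
rewrite [LHS]ge0_integral_gauss2//.
rewrite [LHS](@ge0_integral_planar _ a b d e (c * z) (f * z))//; last 2 first.
- exact: emeasurable_funM.
- by move=> y; rewrite mule_ge0// lee_fin mulr_ge0 ?normal_pdf_ge0.
have mFNz : measurable_fun setT (fun p => F (N z p)).
  exact: (measurableT_comp mFN (pair1_measurable z)).
rewrite ge0_integral_gauss2//.
have mFNzkk : measurable_fun setT (fun p => F (N z p) * (k p.1 * k p.2)%:E).
  exact: emeasurable_funM.
rewrite -ge0_integralZr//; last 2 first.
- by move=> y _; rewrite mule_ge0// lee_fin mulr_ge0 ?normal_pdf_ge0.
- by rewrite lee_fin normal_pdf_ge0.
rewrite -ge0_integralZl//; last 2 first.
- apply: (measurableT_comp (f := fun y => G (y, z) * (k y.1 * k y.2)%:E)).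
    exact: emeasurable_funM.
  exact: (measurableT_comp mN (pair1_measurable z)).
- by move=> y _; rewrite mule_ge0// lee_fin mulr_ge0 ?normal_pdf_ge0.
apply: eq_integral => p _.
rewrite /G /g /= -!muleA [LHS]muleCA; congr (_ * _).
rewrite -!EFinM -(gauss2_density_orthonormal p.1 p.2 z h11 h22 h12 D0)//.
by congr EFin; rewrite -/D; ring.
Qed.

End standard_gaussian_invariance.

(** * Borel sets of the plane *)

Section borel_plane.
Context {R : realType}.

(** Open sets of the plane are countable unions of boxes with rational corners, so
    the product sigma-algebra contains them. *)
Lemma open_measurable2 (U : set (R * R)) : open U -> measurable U.
Proof.
move=> oU.
pose box (q : (rat * rat) * (rat * rat)) : set (R * R) :=
  `](ratr q.1.1 : R), ratr q.1.2[%classic `*` `](ratr q.2.1 : R), ratr q.2.2[%classic.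
pose G n : set (R * R) := if unpickle n is Some q then
  if `[< box q `<=` U >] then box q else set0 else set0.
have -> : U = \bigcup_n G n.
  apply/seteqP; split => [x Ux|x [n _]]; last first.
    by rewrite /G; case: (unpickle n) => [q|]//; case: asboolP => // qU /qU.
  have /nbhs_ballP[e /= e0 eU] : nbhs x U by exact: open_nbhs_nbhs.
  have around (y : R) : exists q : rat * rat, [/\ y - e < ratr q.1, ratr q.1 < y,
      y < ratr q.2 & ratr q.2 < y + e].
    have [|q1] := @rat_in_itvoo R (y - e) y; first by rewrite ltrBlDr ltrDl.
    have [|q2] := @rat_in_itvoo R y (y + e); first by rewrite ltrDl.
    rewrite !in_itv/= => /andP[h3 h4] /andP[h1 h2].
    by exists (q1, q2).
  have [q1 [h1 h2 h3 h4]] := around x.1.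
  have [q2 [k1 k2 k3 k4]] := around x.2.
  have qU : box (q1, q2) `<=` U.
    move=> y [/=]; rewrite !in_itv/= => /andP[y1 y2] /andP[y3 y4]; apply: eU.
    by split; rewrite /= /ball/= ltr_norml; apply/andP; split; lra.
  suff [n Gn] : exists n, G n x by exists n.
  exists (pickle (q1, q2)); rewrite /G pickleK; case: asboolP => // _.
  by split; rewrite /= in_itv/= ?h2 ?h3 ?k2 ?k3.
apply: bigcupT_measurable => n; rewrite /G.
case: (unpickle n) => [q|]//; case: asboolP => // _.
exact: measurableX.
Qed.

Lemma continuous_measurable2 (f : R * R -> R) :
  continuous f -> measurable_fun setT f.
Proof.
move=> /continuousP cf; apply: (measurability _ (RGenOpens.measurableE R)).
move=> _ [_ [a [b ->] <-]]; rewrite setTI; apply: open_measurable2.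
exact/cf/interval_open.
Qed.

End borel_plane.

(** * Random recursions driven by independent noise *)

Section rectangles.
Local Open Scope ereal_scope.
Context d1 d2 (T1 : measurableType d1) (T2 : measurableType d2) {R : realType}.

Lemma measure_eq_rectangles (m1 m2 : {measure set (T1 * T2) -> \bar R}) :
  m1 setT < +oo ->
  (forall A B, measurable A -> measurable B -> m1 (A `*` B) = m2 (A `*` B)) ->
  forall X, measurable X -> m1 X = m2 X.
Proof.
move=> m1oo m12 X mX.
pose C : set (set (T1 * T2)) := [set A `*` B | A in measurable & B in measurable].
apply: (measure_unique C (fun=> setT)) => //.
- exact: measurable_prod_measurableType.
- move=> _ _ [A mA [B mB <-]] [A' mA' [B' mB' <-]].
  exists (A `&` A'); first exact: measurableI.
  by exists (B `&` B'); [exact: measurableI|rewrite setXI].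
- by move=> _; exists setT => //; exists setT => //; rewrite setXTT.
- by rewrite bigcup_const.
- by move=> _ [A mA [B mB <-]]; exact: m12.
Qed.

End rectangles.

Section stationary_recursion.
Local Open Scope ereal_scope.
Context {R : realType} d (T : measurableType d) (P : probability T R).
Context d' (S : measurableType d') (mu : probability S R) (G : probability R R).
Variables (Y : nat -> T -> R) (g : S * R -> S).
Hypotheses (mY : forall i, measurable_fun setT (Y i)) (mg : measurable_fun setT g).
Hypothesis lawY : forall i B, measurable B -> P (Y i @^-1` B) = G B.
Hypothesis indepY : forall n, mutually_independent P Y n.

Fixpoint recursion (x : S) (n : nat) (w : T) : S :=
  if n is m.+1 then g (recursion x m w, Y m w) else x.

Let X n (z : S * T) : S := recursion z.1 n z.2.

Lemma measurable_recursion n :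
  measurable_fun setT (fun z : S * T => recursion z.1 n z.2).
Proof.
elim: n => [|n IHn]; first exact: measurable_fst.
apply: (measurableT_comp mg); apply/measurable_fun_pairP; split => //.
exact: (measurableT_comp (mY n)).
Qed.

Let Q : probability (S * T)%type R := (mu \x P).

Let future (B : nat -> set R) n := \bigcap_(i < n) (Y i @^-1` B i).

Let mX n D : measurable D -> measurable (X n @^-1` D).
Proof. by move=> mD; rewrite -[_ @^-1` _]setTI; exact: measurable_recursion. Qed.

Let mYi i B : measurable B -> measurable (Y i @^-1` B).
Proof. by move=> mB; rewrite -[_ @^-1` _]setTI; exact: mY. Qed.

Let mfuture B n : (forall i, measurable (B i)) -> measurable (future B n).
Proof.
move=> mB; rewrite /future bigcap_mkord.
by apply: bigsetI_measurable => i _; exact: mYi.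
Qed.

Let setX_preimage (E : set T) : snd @^-1` E = [set: S] `*` E.
Proof. by rewrite setTX. Qed.

Let future_set B m n C : (m < n)%N -> (forall i, measurable (B i)) ->
  B m = setT -> measurable C ->
  future (fun i => if i == m then C else B i) n = Y m @^-1` C `&` future B n /\
  P (future (fun i => if i == m then C else B i) n) = G C * P (future B n).
Proof.
move=> mn mB Bm mC; split.
  apply/seteqP; split => w.
    move=> h; split; first by have := h m mn; rewrite eqxx.
    move=> i /= im; have := h i im; case: eqP => // -> _.
    by rewrite /= Bm.
  by move=> [Cw h] i /= im; case: eqP => [->//|_]; exact: h.
rewrite /future !indepY//; last by move=> i; case: eqP.
rewrite (bigD1 (Ordinal mn))//= [in RHS](bigD1 (Ordinal mn))//= eqxx.
rewrite Bm preimage_setT probability_setT mul1e lawY//; congr (_ * _).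
by apply: eq_bigr => i; rewrite -val_eqE/= => /negbTE ->.
Qed.

Let indep_future m := forall n (B : nat -> set R) D, (m < n)%N ->
  (forall i, measurable (B i)) -> (forall i, (i < m)%N -> B i = setT) ->
  measurable D ->
  Q (X m @^-1` D `&` snd @^-1` future B n) = Q (X m @^-1` D) * P (future B n).

Let indep_future_next m : indep_future m -> forall C D, measurable C -> measurable D ->
  Q (X m @^-1` D `&` (Y m \o snd) @^-1` C) = Q (X m @^-1` D) * G C.
Proof.
move=> indep C D mC mD.
have [] := @future_set (fun=> setT) m m.+1 C (ltnSn m) (fun=> measurableT) erefl mC.
have -> : future (fun=> setT) m.+1 = setT by apply/seteqP; split => // w _ i.
rewrite probability_setT mule1 setIT => h1 h2.
rewrite -h2 -indep//.
- by rewrite h1.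
- by move=> i; case: eqP.
- by move=> i im; case: eqP => [ieq|//]; move: im; rewrite ieq ltnn.
Qed.

(** The state reached after [m] steps is independent of the increments from the
    [m]th on; in the inductive step the pair (state, [m]th increment) is shown to
    be independent of the later increments by comparing two finite measures on
    rectangles. *)
Let recursion_indep_future m : indep_future m.
Proof.
elim: m => [|m IHm] n B D mn mB BT mD.
  rewrite (_ : _ `&` _ = D `*` future B n); last by apply/seteqP; split.
  rewrite (_ : X 0 @^-1` D = D `*` setT); last by apply/seteqP; split => [z Dz|z []].
  have -> : Q (D `*` setT) = mu D.
    transitivity (mu D * P setT); first exact: product_measure1E.
    by rewrite probability_setT mule1.
  by apply: product_measure1E => //; exact: mfuture.
have mn' : (m < n)%N by exact: ltnW.
have Bm : B m = setT by exact: BT.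
have BT' i : (i < m)%N -> B i = setT by move=> im; apply: BT; exact: ltnW.
have IHC C D' : measurable C -> measurable D' ->
    Q (X m @^-1` D' `&` (Y m \o snd) @^-1` C `&` snd @^-1` future B n) =
    Q (X m @^-1` D') * (G C * P (future B n)).
  move=> mC mD'.
  have [h1 h2] := future_set mn' mB Bm mC.
  rewrite -h2 -IHm//.
  - by rewrite h1 preimage_setI setIA.
  - by move=> i; case: eqP.
  - by move=> i im; case: eqP => [ieq|_]; [move: im; rewrite ieq ltnn|exact: BT'].
have IHC1 := indep_future_next IHm.
set E := snd @^-1` future B n.
have mE : measurable E by rewrite /E setX_preimage; apply: measurableX => //; exact: mfuture.
have mXY : measurable_fun setT (fun z => (X m z, Y m z.2)).
  apply/measurable_fun_pairP; split; first exact: measurable_recursion.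
  exact: (measurableT_comp (mY m)).
pose XY : {mfun (S * T)%type >-> (S * R)%type} := mfun_Sub (mem_set mXY).
have PEge0 : (0 <= fine (P (future B n)))%R by exact: fine_ge0.
pose PE := NngNum PEge0.
have PEE : P (future B n) = (PE%:num)%:E.
  by rewrite /PE/= fineK//; apply: fin_num_measure; exact: mfuture.
have [n1 n1E] : exists n1 : {measure set (S * R) -> \bar R},
    forall A, n1 A = Q (XY @^-1` A `&` E).
  by unshelve eexists (pushforward (mrestr Q mE) XY : {measure set _ -> \bar R}).
pose n2 : {measure set (S * R) -> \bar R} := mscale PE (distribution Q XY).
have n2E A : n2 A = P (future B n) * Q (XY @^-1` A) by rewrite PEE.
suff key : n1 (g @^-1` D) = n2 (g @^-1` D) by rewrite n1E n2E muleC in key.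
apply: measure_eq_rectangles.
- rewrite n1E; apply: le_lt_trans (ltry 1); apply: probability_le1.
  by rewrite preimage_setT setTI.
- move=> A C mA mC; rewrite n1E n2E.
  rewrite (_ : XY @^-1` (A `*` C) = X m @^-1` A `&` (Y m \o snd) @^-1` C)//.
  by rewrite IHC// IHC1// muleA [LHS]muleC.
- by rewrite -[_ @^-1` _]setTI; exact: mg.
Qed.

Hypothesis muG : forall D, measurable D -> (mu \x G) (g @^-1` D) = mu D.

Lemma recursion_stationary n D : measurable D ->
  (mu \x P) [set z | D (recursion z.1 n z.2)] = mu D.
Proof.
elim: n D => [|n IHn] D mD.
  rewrite (_ : [set _ | _] = D `*` setT); last by apply/seteqP; split => [z Dz|z []].
  transitivity (mu D * P setT); first exact: product_measure1E.
  by rewrite probability_setT mule1.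
rewrite -muG//.
have mXY : measurable_fun setT (fun z => (X n z, Y n z.2)).
  apply/measurable_fun_pairP; split; first exact: measurable_recursion.
  exact: (measurableT_comp (mY n)).
pose XY : {mfun (S * T)%type >-> (S * R)%type} := mfun_Sub (mem_set mXY).
transitivity (distribution Q XY (g @^-1` D)); first by [].
apply: measure_eq_rectangles.
- by apply: le_lt_trans (ltry 1); exact: probability_le1.
- move=> A C mA mC.
  transitivity (Q (X n @^-1` A `&` (Y n \o snd) @^-1` C)); first by [].
  rewrite (indep_future_next (@recursion_indep_future n))//.
  transitivity (mu A * G C); last by apply/esym; exact: product_measure1E.
  by congr (_ * _); exact: IHn.
- by rewrite -[_ @^-1` _]setTI; exact: mg.
Qed.

End stationary_recursion.

(** * Uniqueness of the invariant measure *)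

Section measure_determination.
Context {R : realType}.
Local Open Scope ereal_scope.

Lemma measure_eq_rays (m1 m2 : {measure set R -> \bar R}) :
  m1 setT < +oo ->
  (forall a : R, m1 `]a, +oo[%classic = m2 `]a, +oo[%classic) ->
  forall A, measurable A -> m1 A = m2 A.
Proof.
move=> m1oo m12 A mA.
pose G : set (set R) := [set X | exists a : R, X = `]a, +oo[%classic].
apply: (measure_unique G (fun n => `](- n%:R)%R, +oo[%classic)) => //.
- exact: (RGenOInfty.measurableE R).
- move=> _ _ [a ->] [b ->]; exists (Num.max a b).
  apply/seteqP; split => x /=; rewrite !in_itv/= !andbT gt_max.
    by move=> [-> ->].
  by move=> /andP[].
- by move=> n; exists (- n%:R)%R.
- apply/seteqP; split => // x _; exists (Num.bound `|x|%R) => //=.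
  rewrite in_itv/= andbT ltrNl (le_lt_trans (ler_norm _))// normrN.
  exact: archi_boundP.
- by move=> _ [a ->].
- move=> n; apply: le_lt_trans m1oo; apply: le_measure; rewrite ?inE//.
Qed.

(** Rectangles reduce to quadrants one factor at a time: with one factor fixed, a
    measure of the plane restricts to a measure of the line. *)
Lemma measure_eq_quadrants (m1 m2 : {measure set (R * R) -> \bar R}) :
  m1 setT < +oo -> m2 setT < +oo ->
  (forall a b : R, m1 (`]a, +oo[%classic `*` `]b, +oo[%classic) =
                   m2 (`]a, +oo[%classic `*` `]b, +oo[%classic)) ->
  forall A, measurable A -> m1 A = m2 A.
Proof.
move=> m1oo m2oo m12; apply: measure_eq_rectangles => // A B mA mB.
have slice1 (m : {measure set (R * R) -> \bar R}) D : measurable D ->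
    exists n : {measure set R -> \bar R}, forall A, n A = m (A `*` D).
  move=> mD; have mE : measurable ([set: R] `*` D) by exact: measurableX.
  unshelve eexists (pushforward (mrestr m mE) fst : {measure set _ -> \bar R}) => //.
  move=> X; rewrite [LHS]/(mrestr _ _ _) /=; congr (m _).
  by apply/seteqP; split => -[x y] /=; tauto.
have slice2 (m : {measure set (R * R) -> \bar R}) D : measurable D ->
    exists n : {measure set R -> \bar R}, forall A, n A = m (D `*` A).
  move=> mD; have mE : measurable (D `*` [set: R]) by exact: measurableX.
  unshelve eexists (pushforward (mrestr m mE) snd : {measure set _ -> \bar R}) => //.
  move=> X; rewrite [LHS]/(mrestr _ _ _) /=; congr (m _).
  by apply/seteqP; split => -[x y] /=; tauto.
have [n1 n1E] := slice2 m1 A mA; have [n2 n2E] := slice2 m2 A mA.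
rewrite -n1E -n2E; apply: measure_eq_rays mB.
  rewrite n1E; apply: le_lt_trans m1oo; apply: le_measure; rewrite ?inE//.
  exact: measurableX.
move=> b; rewrite n1E n2E.
have [l1 l1E] := slice1 m1 `]b, +oo[%classic (measurable_itv _).
have [l2 l2E] := slice1 m2 `]b, +oo[%classic (measurable_itv _).
rewrite -l1E -l2E; apply: measure_eq_rays mA.
  rewrite l1E; apply: le_lt_trans m1oo; apply: le_measure; rewrite ?inE//.
  exact: measurableX.
by move=> a; rewrite l1E l2E.
Qed.

End measure_determination.

Section ramps.
Context {R : realType}.
Local Open Scope ring_scope.

(** A [k]-Lipschitz approximation of the indicator of [t > a]; only Lipschitz test
    functions can be compared along two merging trajectories. *)
Definition ramp (k a t : R) : R := Num.max 0 (Num.min 1 (k * (t - a))).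

Lemma ramp_itv k a t : 0 <= ramp k a t <= 1.
Proof. by rewrite /ramp le_max lexx/= ge_max ler01 ge_min lexx. Qed.

Lemma ramp_lipschitz k a t u : 0 <= k -> `|ramp k a t - ramp k a u| <= k * `|t - u|.
Proof.
move=> k0; rewrite -[k in leRHS]ger0_norm// -normrM mulrBr.
have -> : k * t - k * u = k * (t - a) - k * (u - a) by ring.
rewrite /ramp; move: (k * (t - a)) (k * (u - a)) => x y.
have [n1 n2] : `|x - y| >= x - y /\ `|x - y| >= y - x.
  by split; [exact: ler_norm|rewrite distrC; exact: ler_norm].
rewrite ler_norml; apply/andP; rewrite !maxElt !minElt.
by split; case: (ltP 1 x) => ?; case: (ltP 1 y) => ?; case: ltP => ?; case: ltP => ?; lra.
Qed.

Lemma ramp_cvg a t : ramp n%:R a t @[n --> \oo] --> ((a < t)%R%:R : R).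
Proof.
have [ta|at_] := leP t a.
  apply: cvg_near_cst; near=> n; rewrite /ramp; apply/max_idPl.
  by rewrite ge_min; apply/orP; right; rewrite mulr_ge0_le0// subr_le0.
apply: cvg_near_cst; near=> n.
have nt : (t - a)^-1 <= n%:R by near: n; exact: nbhs_infty_ger.
rewrite /ramp (min_idPl _); first by apply/max_idPr.
by rewrite -ler_pdivrMr ?subr_gt0// mul1r.
Unshelve. all: by end_near. Qed.

Lemma continuous_ramp k a : continuous (ramp k a).
Proof.
move=> t; apply: (@continuous_max _ R (cst 0) (fun t => Num.min 1 (k * (t - a)))).
  exact: cvg_cst.
apply: (@continuous_min _ R (cst 1) (fun t => k * (t - a))); first exact: cvg_cst.
apply: cvgM; first exact: cvg_cst.
by apply: (@cvgB _ R^o); [exact: cvg_id|exact: cvg_cst].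
Qed.

End ramps.

Lemma probability_integrable {R : realType} d (S : measurableType d)
    (mu : probability S R) (f : S -> \bar R) (c : R) :
  measurable_fun setT f -> (forall x, `|f x| <= c%:E)%E -> mu.-integrable setT f.
Proof.
move=> mf fc; apply: (le_integrable measurableT mf (g := EFin \o cst c)).
  by move=> x _; apply: le_trans (fc x) _; rewrite lee_fin ler_norm.
exact: finite_measure_integrable_cst.
Qed.

Section coupling.
Context {R : realType} d (T : measurableType d) (P : probability T R).
Variable X : nat -> R * R -> T -> R * R.
Hypothesis mX : forall n, measurable_fun setT (fun z : (R * R) * T => X n z.1 z.2).
Hypothesis contraction : forall x, exists2 delta : nat -> R, delta @ \oo --> (0 : R) &
  forall n w, `|(X n x w).1 - (X n 0 w).1| + `|(X n x w).2 - (X n 0 w).2| <= delta n.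

Let invariant (mu : probability (R * R)%type R) :=
  forall (phi : R * R -> R) n, continuous phi -> bounded_fun phi ->
    (\int[mu]_x 'E_P[fun w => phi (X n x w)] = \int[mu]_x (phi x)%:E)%E.

(** Two copies of the process driven by the same noise merge, so the average of a
    Lipschitz function after [n] steps forgets the starting point. *)
Lemma invariant_expectation_cvg mu (phi : R * R -> R) (k : R) : invariant mu ->
  0 <= k -> (forall x, 0 <= phi x <= 1) -> continuous phi ->
  (forall x y, `|phi x - phi y| <= k * (`|x.1 - y.1| + `|x.2 - y.2|)) ->
  ('E_P[fun w => phi (X n 0%R w)] @[n --> \oo] --> \int[mu]_x (phi x)%:E)%E.
Proof.
move=> inv k0 phi01 cphi lip.
have mphi := continuous_measurable2 cphi.
have phi_ge0 x : 0 <= phi x by have /andP[] := phi01 x.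
have phi_le1 x : phi x <= 1 by have /andP[] := phi01 x.
have bphi : bounded_fun phi.
  exists 1; split => // M M1 x _ /=; rewrite ger0_norm//.
  exact: le_trans (phi_le1 x) (ltW M1).
pose F n x := ('E_P[fun w => phi (X n x w)])%E.
have mXx n x : measurable_fun setT (fun w => phi (X n x w)).
  apply: measurableT_comp => //.
  exact: (measurableT_comp (mX n) (pair1_measurable x)).
have iX n x : P.-integrable setT (fun w => (phi (X n x w))%:E).
  apply: (@probability_integrable _ _ _ _ _ 1); first exact/measurable_EFinP.
  by move=> w; rewrite lee_fin ger0_norm.
have FE n x : F n x = (\int[P]_w (phi (X n x w))%:E)%E by rewrite /F unlock.
have F_ge0 n x : (0 <= F n x)%E.
  by rewrite FE; apply: integral_ge0 => w _; rewrite lee_fin.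
have F_le1 n x : (F n x <= 1)%E.
  rewrite FE -(probability_setT P) -[leRHS]mul1e -integral_cst//.
  by apply: ge0_le_integral => //;
    [move=> w _; rewrite lee_fin|exact/measurable_EFinP|move=> w _; rewrite lee_fin].
have F_fin n x : F n x \is a fin_num.
  by rewrite fin_numElt (lt_le_trans _ (F_ge0 n x))// (le_lt_trans (F_le1 n x)) ?ltry.
have mF n : measurable_fun setT (F n).
  rewrite (_ : F n = fun x => (\int[P]_w (phi (X n x w))%:E)%E); last exact/funext.
  have := @measurable_fun_fubini_tonelli_F _ _ _ _ _ P
    (fun z : (R * R) * T => (phi (X n z.1 z.2))%:E); apply.
  - by apply/measurable_EFinP; exact: measurableT_comp.
  - by move=> z; rewrite lee_fin.
pose g n x := (F n x - F n 0%R)%E.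
have g0 x : g n x @[n --> \oo] --> 0%E.
  have [delta delta0 Hd] := contraction x.
  apply/cvg_abse0P; apply: (@squeeze_cvge _ _ _ _ (cst 0%E) _ (fun n => (k * delta n)%:E)).
  - apply: nearW => n; rewrite abse_ge0/=.
    rewrite /g !FE -integralB//; apply: le_trans (le_abse_integral _ _ _) _ => //.
      by apply: emeasurable_funB; exact/measurable_EFinP.
    rewrite -[leRHS]mule1 -(probability_setT P) -integral_cst//.
    apply: ge0_le_integral => //.
    + apply: measurableT_comp => //.
      by apply: emeasurable_funB; exact/measurable_EFinP.
    + move=> w _; rewrite -EFinB/= lee_fin (le_trans (lip _ _))//.
      by rewrite ler_wpM2l.
  - exact: cvg_cst.
  - rewrite -[0%E]/(0%:E) -(mulr0 k); apply: cvg_EFin; first exact: nearW.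
    by apply: cvgM => //; exact: cvg_cst.
have : (\int[mu]_x g n x @[n --> \oo] --> \int[mu]_x (cst 0 x))%E.
  apply: (@dominated_cvg _ _ _ mu setT measurableT g (cst 0%E) (cst 1%E)) => //.
  - by move=> n; apply: emeasurable_funB.
  - exact: finite_measure_integrable_cst.
  - move=> n x _; rewrite /g -(fineK (F_fin n x)) -(fineK (F_fin n 0)) -EFinB lee_fin ler_norml.
    have h y : 0 <= fine (F n y) <= 1 by rewrite -!lee_fin fineK// F_ge0 F_le1.
    have /andP[h1 h2] := h x; have /andP[h3 h4] := h 0.
    by apply/andP; split; lra.
rewrite integral_cst// mul0e.
have gE n : (\int[mu]_x g n x = \int[mu]_x (phi x)%:E - F n 0%R)%E.
  rewrite -(inv phi n cphi bphi) integralB//.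
  - by rewrite integral_cst// [X in (_ - _ * X)%E]probability_setT mule1.
  - by apply: (@probability_integrable _ _ _ _ _ 1) => // x; rewrite gee0_abs.
  - by apply: (@probability_integrable _ _ _ _ _ 1) => // x; rewrite gee0_abs.
under eq_fun do rewrite gE.
set c := (\int[mu]_x (phi x)%:E)%E => gcvg.
have c_fin : c \is a fin_num.
  rewrite /c integrable_fin_num//; apply: (@probability_integrable _ _ _ _ _ 1).
    exact/measurable_EFinP.
  by move=> x; rewrite lee_fin ger0_norm.
have -> : (fun n => 'E_P[fun w => phi (X n 0%R w)])%E = (fun n => c - (c - F n 0%R))%E.
  apply/funext => n; rewrite -/(F n 0%R) -(fineK c_fin) -(fineK (F_fin n 0)).
  by rewrite -!EFinB subKr.
have : (c - (c - F n 0%R) @[n --> \oo] --> c - 0)%E.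
  by apply: cvgeB => //; [rewrite fin_num_adde_defl|exact: cvg_cst].
by rewrite sube0.
Qed.

(** Products of two ramps are Lipschitz, hence have equal integrals against both
    measures, and they converge to the indicators of quadrants. *)
Lemma coupled_invariant_unique (mu1 mu2 : probability (R * R)%type R) :
  invariant mu1 -> invariant mu2 -> forall B, measurable B -> mu1 B = mu2 B.
Proof.
move=> inv1 inv2; apply: measure_eq_quadrants.
- by rewrite [ltLHS]probability_setT ltry.
- by rewrite [ltLHS]probability_setT ltry.
move=> a b.
pose phi (k : nat) (x : R * R) : R := ramp k%:R a x.1 * ramp k%:R b x.2.
have cphi k : continuous (phi k).
  move=> x; apply: cvgM.
    by apply: (cvg_comp _ _ cvg_fst); exact: continuous_ramp.
  by apply: (cvg_comp _ _ cvg_snd); exact: continuous_ramp.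
have phi01 k x : 0 <= phi k x <= 1.
  have /andP[h1 h2] := ramp_itv k%:R a x.1; have /andP[h3 h4] := ramp_itv k%:R b x.2.
  by rewrite mulr_ge0//= mulr_ile1.
have lip k x y : `|phi k x - phi k y| <= k%:R * (`|x.1 - y.1| + `|x.2 - y.2|).
  have /andP[h1 h2] := ramp_itv k%:R a y.1; have /andP[h3 h4] := ramp_itv k%:R b x.2.
  have l1 := ramp_lipschitz a x.1 y.1 (ler0n R k).
  have l2 := ramp_lipschitz b x.2 y.2 (ler0n R k).
  have -> : phi k x - phi k y = (ramp k%:R a x.1 - ramp k%:R a y.1) * ramp k%:R b x.2
     + ramp k%:R a y.1 * (ramp k%:R b x.2 - ramp k%:R b y.2) by rewrite /phi; ring.
  rewrite [leRHS]mulrDr (le_trans (ler_normD _ _))// lerD// normrM.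
    by rewrite (le_trans _ l1)// ler_piMr// ger0_norm.
  by rewrite (le_trans _ l2)// ler_piMl// ger0_norm.
have phiE k : (\int[mu1]_x (phi k x)%:E = \int[mu2]_x (phi k x)%:E)%E.
  have c1 := invariant_expectation_cvg inv1 (ler0n R k) (phi01 k) (cphi k) (lip k).
  have c2 := invariant_expectation_cvg inv2 (ler0n R k) (phi01 k) (cphi k) (lip k).
  by rewrite -(cvg_lim _ c1)// -(cvg_lim _ c2).
set Q := _ `*` _.
have mQ : measurable Q by exact: measurableX.
have lim_phi (mu : probability (R * R)%type R) :
    (\int[mu]_x (phi k x)%:E @[k --> \oo] --> mu Q)%E.
  have -> : mu Q = (\int[mu]_x (\1_Q x)%:E)%E by rewrite integral_indic// setIT.
  apply: (@dominated_cvg _ _ _ mu setT measurableT (fun k x => (phi k x)%:E) _ (cst 1%E)) => //.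
  - by move=> k; apply/measurable_EFinP; exact: continuous_measurable2.
  - move=> x _; apply: cvg_EFin; first exact: nearW.
    have -> : \1_Q x = (a < x.1)%R%:R * (b < x.2)%R%:R :> R.
      rewrite indicE; case: (boolP (x \in Q)) => [/set_mem|/negP xQ].
        by move=> [/=]; rewrite !in_itv/= !andbT => -> ->; rewrite mulr1.
      have [ax|] := ltP a x.1; have [bx|] := ltP b x.2; rewrite ?mulr0 ?mul0r//.
      by case: xQ; apply/mem_set; split; rewrite /= in_itv/= ?ax ?bx.
    by apply: cvgM; exact: ramp_cvg.
  - exact: finite_measure_integrable_cst.
  - move=> k x _; have /andP[h1 h2] := phi01 k x.
    by rewrite /= lee_fin ger0_norm.
have l1 := lim_phi mu1; have l2 := lim_phi mu2.
rewrite -[LHS](cvg_lim _ l1)// -[RHS](cvg_lim _ l2)//.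
by congr (limn _); apply/funext.
Qed.

End coupling.

(** * Large deviations of centred Gaussian laws *)

Section gaussian_tails.
Context {R : realType}.
Local Notation leb := (@lebesgue_measure R).
Local Notation k := (normal_pdf (0 : R) 1).

Lemma gaussE (B : set R) : gauss B = normal_prob (0 : R) 1 B.
Proof. by []. Qed.

(** Gaussian exponential moments below the critical exponent: the integrand is a
    multiple of the density of [N(0, sg ^ 2)]. *)
Lemma gauss_exp_moment (sg : R) : 1 <= sg ->
  exists M : R, (\int[gauss]_u (expR ((1 - sg ^- 2) * u ^+ 2 / 2))%:E = M%:E)%E.
Proof.
move=> sg1; have sg0 : sg != 0 by rewrite gt_eqF// (lt_le_trans ltr01).
exists (normal_peak 1 / normal_peak sg).
rewrite ge0_integral_gauss; last 2 first.
- apply/measurable_EFinP; apply: measurableT_comp => //.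
  by apply: measurable_funM => //; apply: measurable_funM => //; exact: measurable_funX.
- by move=> u; rewrite lee_fin expR_ge0.
have pk0 : normal_peak sg != 0 by rewrite gt_eqF// normal_peak_gt0.
transitivity (\int[leb]_u ((normal_peak 1 / normal_peak sg)%:E * (normal_pdf 0 sg u)%:E))%E.
  apply: eq_integral => u _; rewrite -!EFinM !normal_pdfE ?oner_eq0//; congr EFin.
  rewrite /normal_fun mulrCA [RHS]mulrA divfK// -expRD; congr (_ * expR _).
  by field.
rewrite ge0_integralZl//; last 3 first.
- by apply/measurable_EFinP; exact: measurable_normal_pdf.
- by move=> u _; rewrite lee_fin normal_pdf_ge0.
- by rewrite lee_fin divr_ge0 ?normal_peak_ge0.
by rewrite integral_normal_pdf mule1.
Qed.

Lemma gauss2_exp_moment (sg : R) : 1 <= sg ->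
  exists M : R, (\int[gauss2]_p (expR ((1 - sg ^- 2) * ((p.1 ^+ 2 + p.2 ^+ 2) / 2)))%:E = M%:E)%E.
Proof.
have sg0 : 1 <= sg -> sg != 0 by move=> sg1; rewrite gt_eqF// (lt_le_trans ltr01).
move=> sg1; have {}sg0 := sg0 sg1; have [M HM] := gauss_exp_moment sg1; exists (M * M).
pose e u := expR ((1 - sg ^- 2) * u ^+ 2 / 2).
have me : measurable_fun setT e.
  apply: measurableT_comp => //.
  by apply: measurable_funM => //; apply: measurable_funM => //; exact: measurable_funX.
have e0 u : 0 <= e u by exact: expR_ge0.
transitivity (\int[gauss2]_p ((e p.1)%:E * (e p.2)%:E))%E.
  by apply: eq_integral => p _; rewrite -EFinM -expRD; congr (expR _)%:E; field.
rewrite (fubini_tonelli1 (m1 := gauss) (m2 := gauss))//; last 2 first.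
- by apply: emeasurable_funM; apply/measurable_EFinP; exact: measurableT_comp.
- by move=> p; rewrite mule_ge0// lee_fin.
transitivity (\int[gauss]_u ((e u)%:E * M%:E))%E.
  apply: eq_integral => u _; rewrite -HM /fubini_F/= ge0_integralZl//.
  + exact/measurable_EFinP.
  + by move=> v _; rewrite lee_fin.
  + by rewrite lee_fin.
rewrite ge0_integralZr//.
- by rewrite HM EFinM.
- exact/measurable_EFinP.
- by move=> v _; rewrite lee_fin.
- by rewrite -HM; apply: integral_ge0 => u _; rewrite lee_fin.
Qed.

Lemma gauss_itv_lower (y l m : R) : 0 <= l -> `|y| <= m -> `|y + l| <= m ->
  ((l * (normal_peak 1 * expR (- m ^+ 2 / 2)))%:E <= gauss `]y, (y + l)%R[%classic)%E.
Proof.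
move=> l0 ym ylm; rewrite gaussE /normal_prob.
have cst_int : (\int[leb]_(x in `]y, (y + l)%R[) (normal_peak 1 * expR (- m ^+ 2 / 2))%:E =
    (l * (normal_peak 1 * expR (- m ^+ 2 / 2)))%:E)%E.
  rewrite integral_cst//= lebesgue_measure_itv/= lte_fin ltrDl.
  move: l0; rewrite le_eqVlt => /orP[/eqP <-|->]; first by rewrite ltxx mul0r mule0.
  by rewrite -EFinB -EFinM addrAC subrr add0r mulrC.
rewrite -cst_int; apply: ge0_le_integral => //.
- by move=> x _; rewrite lee_fin mulr_ge0 ?expR_ge0 ?normal_peak_ge0.
- by apply/measurable_EFinP/measurable_funTS; exact: measurable_normal_pdf.
- move=> x; rewrite /= in_itv/= => /andP[yx xy].
  rewrite lee_fin normal_pdfE ?oner_eq0// ler_wpM2l ?normal_peak_ge0//.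
  rewrite ler_expR subr0 expr1n -mulr_natr mul1r ler_pM2r ?invr_gt0//.
  rewrite lerN2 -(real_normK (num_real x)) -(real_normK (num_real m)) ler_sqr ?nnegrE//.
  rewrite (le_trans _ (ler_norm m))//.
  move: ym ylm; rewrite !ler_norml => /andP[h1 h2] /andP[h3 h4].
  by apply/andP; split; lra.
Qed.

End gaussian_tails.

Section triangular_gaussian.
Context {R : realType}.

Definition lower_triangular (s t r : R) (x : R * R) : R * R :=
  (s * x.1, t * x.1 + r * x.2).

Lemma measurable_lower_triangular s t r :
  measurable_fun setT (lower_triangular s t r).
Proof.
apply/measurable_fun_pairP; split; first exact: measurable_funM.
by apply: measurable_funD; exact: measurable_funM.
Qed.

HB.instance Definition _ s t r :=
  isMeasurableFun.Build _ _ _ _ _ (measurable_lower_triangular s t r).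

Definition gaussian_law (s t r : R) : probability (R * R)%type R :=
  distribution gauss2 (lower_triangular s t r).

(** Half of the squared norm of the preimage of [x] by [lower_triangular s t r]. *)
Definition gaussian_rate (s t r : R) (x : R * R) : R :=
  ((x.1 / s) ^+ 2 + ((x.2 - t * (x.1 / s)) / r) ^+ 2) / 2.

Lemma gaussian_rateE s t r x : s != 0 -> r != 0 ->
  gaussian_rate s t r (lower_triangular s t r x) = (x.1 ^+ 2 + x.2 ^+ 2) / 2.
Proof. by move=> s0 r0; rewrite /gaussian_rate /=; field; rewrite s0 r0. Qed.

Lemma gaussian_rate_ge0 s t r x : 0 <= gaussian_rate s t r x.
Proof. by rewrite divr_ge0// addr_ge0 ?sqr_ge0. Qed.

End triangular_gaussian.

Section asymptotic_bounds.
Context {R : realType}.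
Implicit Types f : R -> \bar R.
Local Open Scope ereal_scope.

Lemma limf_esup_le_near f (c : R) :
  (forall eta : R, (0 < eta)%R -> \forall eps \near 0^'+, f eps <= (c + eta)%:E) ->
  limf_esup f 0^'+ <= c%:E.
Proof.
move=> h; apply/lee_addgt0Pr => eta eta0; rewrite -EFinD.
apply: ge_ereal_inf; exists (ereal_sup (f @` [set eps | f eps <= (c + eta)%:E])).
  by exists [set eps | f eps <= (c + eta)%:E] => //; exact: h.
by apply: ge_ereal_sup => _ [eps /= + <-].
Qed.

Lemma limf_einf_ge_near f (c : R) :
  (forall eta : R, (0 < eta)%R -> \forall eps \near 0^'+, (c - eta)%:E <= f eps) ->
  c%:E <= limf_einf f 0^'+.
Proof.
move=> h; rewrite /limf_einf leeNr -EFinN; apply: limf_esup_le_near => eta /h.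
by apply: filterS => eps; rewrite leeNl -EFinN opprD opprK.
Qed.

End asymptotic_bounds.

Section gaussian_large_deviations.
Context {R : realType}.
Variables s t r : R.
Hypotheses (s0 : s != 0) (r0 : r != 0).

Let mu (eps : R) := gaussian_law (Num.sqrt eps * s) (Num.sqrt eps * t) (Num.sqrt eps * r).
Let I := gaussian_rate s t r.

Let mu_lower_triangular eps x : lower_triangular (Num.sqrt eps * s)
  (Num.sqrt eps * t) (Num.sqrt eps * r) x =
  lower_triangular s t r (Num.sqrt eps * x.1, Num.sqrt eps * x.2).
Proof. by congr pair => /=; ring. Qed.

(** Chernoff bound: on the event considered, the exponential moment of exponent
    [1 - sg ^- 2 < 1] is at least [expR ((1 - sg ^- 2) * a / eps)]. *)
Lemma gaussian_law_chernoff (sg : R) : 1 <= sg -> exists2 M : R, 0 < M &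
  forall eps a C, 0 < eps -> measurable C -> (forall x, C x -> a <= I x) ->
    (mu eps C <= (M * expR (- ((1 - sg ^- 2) * (a / eps))))%:E)%E.
Proof.
move=> sg1; have [M HM] := gauss2_exp_moment sg1.
have sg2 : 0 <= 1 - sg ^- 2.
  by rewrite subr_ge0 invf_le1 ?exprn_gt0 ?(lt_le_trans ltr01)// expr_ge1// (le_trans ler01).
have M0 : 0 <= M by rewrite -lee_fin -HM; apply: integral_ge0 => p _; rewrite lee_fin expR_ge0.
exists (M + 1); first by rewrite ltr_wpDl.
move=> eps a C eps0 mC CI; have eps_ge0 := ltW eps0.
set L := lower_triangular (Num.sqrt eps * s) (Num.sqrt eps * t) (Num.sqrt eps * r).
have mLC : measurable (L @^-1` C).
  by rewrite -[_ @^-1` _]setTI; exact: measurable_lower_triangular.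
have LI p : C (L p) -> a / eps <= (p.1 ^+ 2 + p.2 ^+ 2) / 2.
  move=> /CI; rewrite /L mu_lower_triangular /I gaussian_rateE//= !exprMn sqr_sqrtr//.
  move=> h; rewrite ler_pdivrMr// (le_trans h)// le_eqVlt; apply/orP; left; apply/eqP.
  by field.
pose e (p : R * R) := expR ((1 - sg ^- 2) * ((p.1 ^+ 2 + p.2 ^+ 2) / 2)).
have me : measurable_fun setT e.
  apply: measurableT_comp => //; apply: measurable_funM => //; apply: measurable_funM => //.
  by apply: measurable_funD; exact: measurable_funX.
set c := expR (- ((1 - sg ^- 2) * (a / eps))).
apply: (@le_trans _ _ (\int[gauss2]_p (c%:E * (e p)%:E))%E); last first.
  rewrite ge0_integralZl//; last 3 first.
  - exact/measurable_EFinP.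
  - by move=> p _; rewrite lee_fin expR_ge0.
  - by rewrite lee_fin expR_ge0.
  by rewrite HM -EFinM lee_fin mulrC ler_wpM2r ?expR_ge0// lerDl.
have -> : mu eps C = (\int[gauss2]_p (\1_(L @^-1` C) p)%:E)%E.
  transitivity (gauss2 (L @^-1` C)); first by [].
  by rewrite (integral_indic gauss2 measurableT mLC) setIT.
apply: ge0_le_integral => //.
- by apply/measurable_EFinP; exact: measurable_indic.
- by apply: emeasurable_funM => //; exact/measurable_EFinP.
- move=> p _; rewrite -EFinM lee_fin indicE.
  have [/set_mem pC|_] := boolP (p \in L @^-1` C); last by rewrite mulr_ge0 ?expR_ge0.
  rewrite -expRD -[leLHS]expR0 ler_expR addrC subr_ge0.
  exact: (ler_wpM2l sg2 (LI p pC)).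
Qed.

(** The preimage of a box of side [rho] has side [rho / sqrt eps >= rho] in standard
    coordinates, and there the density is at least its value at the largest
    possible absolute value of each coordinate. *)
Lemma gaussian_law_box (y : R * R) (rho : R) : 0 < rho ->
  exists2 c : R, 0 < c & forall eps, 0 < eps -> eps <= 1 -> forall U, measurable U ->
    (forall x, y.1 < x.1 < y.1 + rho -> y.2 < x.2 < y.2 + rho ->
      U (lower_triangular s t r x)) ->
    ((c * expR (- (((`|y.1| + rho) ^+ 2 + (`|y.2| + rho) ^+ 2) / 2 / eps)))%:E <= mu eps U)%E.
Proof.
move=> rho0; exists (rho * normal_peak 1 * (rho * normal_peak 1)).
  by rewrite !mulr_gt0// normal_peak_gt0 ?oner_eq0.
move=> eps eps0 eps1 U mU boxU; have eps_ge0 := ltW eps0.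
set q := Num.sqrt eps.
have q0 : 0 < q by rewrite sqrtr_gt0.
have q1 : q <= 1 by rewrite -[leRHS]sqrtr1 ler_wsqrtr.
have qq : q ^+ 2 = eps by rewrite sqr_sqrtr.
pose B (u : R) := `](u / q), (u / q + rho / q)[%classic.
have bound (u : R) : ((rho * normal_peak 1 * expR (- ((`|u| + rho) ^+ 2 / 2 / eps)))%:E
    <= gauss (B u))%E.
  have m0 : 0 <= (`|u| + rho) / q by rewrite divr_ge0 ?addr_ge0// ltW.
  apply: le_trans (@gauss_itv_lower _ (u / q) (rho / q) ((`|u| + rho) / q) _ _ _).
  - have -> : - ((`|u| + rho) / q) ^+ 2 / 2 = - ((`|u| + rho) ^+ 2 / 2 / eps).
      by rewrite -qq; field; rewrite gt_eqF.
    rewrite lee_fin -mulrA ler_wpM2r ?mulr_ge0 ?expR_ge0 ?normal_peak_ge0//.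
    by rewrite ler_pdivlMr// ler_piMr// ltW.
  - by rewrite divr_ge0// ltW.
  - by rewrite normrM [`|q^-1|]gtr0_norm ?invr_gt0// ler_pM2r ?invr_gt0// lerDl ltW.
  - rewrite -mulrDl normrM [`|q^-1|]gtr0_norm ?invr_gt0// ler_pM2r ?invr_gt0//.
    by rewrite (le_trans (ler_normD _ _))// lerD2l gtr0_norm.
have mB u : measurable (B u) by exact: measurable_itv.
apply: (@le_trans _ _ (gauss (B y.1) * gauss (B y.2))%E).
  apply: le_trans (lee_pmul _ _ (bound y.1) (bound y.2)).
  - rewrite -EFinM lee_fin [leRHS]mulrACA -expRD; apply: ler_wpM2l.
      by rewrite !mulr_ge0 ?normal_peak_ge0// ltW.
    by rewrite ler_expR -opprD -!mulrDl.
  - by rewrite lee_fin !mulr_ge0 ?expR_ge0 ?normal_peak_ge0// ltW.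
  - by rewrite lee_fin !mulr_ge0 ?expR_ge0 ?normal_peak_ge0// ltW.
have <- : gauss2 (B y.1 `*` B y.2) = (gauss (B y.1) * gauss (B y.2))%E.
  exact: product_measure1E.
set L := lower_triangular (Num.sqrt eps * s) (Num.sqrt eps * t) (Num.sqrt eps * r).
have mLU : measurable (L @^-1` U).
  by rewrite -[_ @^-1` _]setTI; exact: measurable_lower_triangular.
apply: (@le_measure _ _ _ gauss2); rewrite ?inE//; first exact: measurableX.
move=> p [b1 b2]; move: b1 b2; rewrite /B /= !in_itv/= -!mulrDl !ltr_pdivrMr// !ltr_pdivlMr// => h1 h2.
by rewrite /L mu_lower_triangular; apply: boxU => /=; rewrite -/q mulrC.
Qed.

End gaussian_large_deviations.

Section gaussian_large_deviation_principle.
Context {R : realType}.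
Variables s t r : R.
Hypotheses (s0 : s != 0) (r0 : r != 0).

Let mu (eps : R) := gaussian_law (Num.sqrt eps * s) (Num.sqrt eps * t) (Num.sqrt eps * r).
Let I := gaussian_rate s t r.

Lemma continuous_gaussian_rate : continuous I.
Proof.
move=> x; rewrite /I /gaussian_rate.
have c1 : y.1 / s @[y --> x] --> x.1 / s.
  by apply: cvgM; [exact: cvg_fst|exact: cvg_cst].
have c2 : (y.2 - t * (y.1 / s)) / r @[y --> x] --> (x.2 - t * (x.1 / s)) / r.
  apply: cvgM; last exact: cvg_cst.
  apply: (@cvgB _ R^o); first exact: cvg_snd.
  by apply: cvgM => //; exact: cvg_cst.
by apply: cvgM; [apply: (@cvgD _ R^o); exact: cvgM|exact: cvg_cst].
Qed.

Lemma continuous_lower_triangular : continuous (lower_triangular s t r).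
Proof.
move=> x.
have c1 : s * y.1 @[y --> x] --> s * x.1.
  by apply: cvgM; [exact: cvg_cst|exact: cvg_fst].
have c2 : t * y.1 + r * y.2 @[y --> x] --> t * x.1 + r * x.2.
  apply: (@cvgD _ R^o); apply: cvgM; (try exact: cvg_cst).
    exact: cvg_fst.
  exact: cvg_snd.
exact: (cvg_pair c1 c2).
Qed.

(** A level set is a closed subset of the image by the Cholesky factor of a large
    square. *)
Lemma gaussian_rate_good : good_rate_function (EFin \o I).
Proof.
split; first split.
- apply/lower_semicontinuousP => a.
  rewrite (_ : [set x | _] = I @^-1` [set y | a < y]); last first.
    by apply/seteqP; split => x /=; rewrite lte_fin.
  by move/continuousP: continuous_gaussian_rate; apply; exact: open_gt.
- by move=> x; rewrite lee_fin gaussian_rate_ge0.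
move=> a a0.
set M := 2 * a + 1.
have M0 : 0 <= M by rewrite addr_ge0// mulr_ge0.
pose K : set (R * R) := `[- M, M]%classic `*` `[- M, M]%classic.
have cK : compact K by apply: compact_setX; exact: segment_compact.
have cLK : compact (lower_triangular s t r @` K).
  apply: continuous_compact => //; apply: continuous_subspaceT.
  exact: continuous_lower_triangular.
apply: subclosed_compact cLK _.
  rewrite (_ : [set x | _] = I @^-1` [set y | y <= a]); last first.
    by apply/seteqP; split => x /=; rewrite lee_fin.
  apply: closed_comp; last exact: closed_le.
  by move=> x _; exact: continuous_gaussian_rate.
move=> x /=; rewrite lee_fin /I /gaussian_rate => Ix.
exists (x.1 / s, (x.2 - t * (x.1 / s)) / r); last first.
  by rewrite /lower_triangular/= [RHS]surjective_pairing; congr pair; field; rewrite ?s0 ?r0.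
move: Ix; set u := x.1 / s; set v := _ / r; rewrite ler_pdivrMr// => Ix.
have MM : a * 2 <= M ^+ 2 by rewrite /M; nra.
by split; rewrite /= in_itv/= -ler_norml -ler_sqr ?nnegrE// real_normK ?num_real//;
  apply: le_trans MM; apply: le_trans Ix; rewrite ?lerDl ?lerDr sqr_ge0.
Qed.

Lemma near_small_mul (c eta : R) : 0 < eta -> \forall eps \near 0^'+, `|eps * c| <= eta.
Proof.
move=> eta0; have c0 : 0 < `|c| + 1 by rewrite ltr_wpDl.
near=> eps; have eps0 : 0 < eps by near: eps; exact: nbhs_right_gt.
rewrite normrM gtr0_norm// (@le_trans _ _ (eps * (`|c| + 1)))//.
  by rewrite ler_wpM2l ?ltW// ltrDl.
rewrite -ler_pdivlMr//; near: eps; apply: nbhs_right_le.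
by rewrite divr_gt0.
Unshelve. all: by end_near. Qed.

(** In the Chernoff bound [eps ln mu] is at most [eps ln M - a + sg ^- 2 * a]; letting
    [sg] grow makes the loss [sg ^- 2 * a] negligible. *)
Lemma gaussian_law_ldp_upper (C : set (R * R)) (a : R) : 0 <= a -> measurable C ->
  (forall x, C x -> a <= I x) ->
  (limf_esup (fun eps : R => eps%:E * lne (mu eps C)) 0^'+ <= (- a)%:E)%E.
Proof.
move=> a0 mC CI; apply: limf_esup_le_near => eta eta0.
pose sg := 1 + 2 * a / eta.
have sg1 : 1 <= sg by rewrite lerDl divr_ge0 ?mulr_ge0// ltW.
have sg_a : sg ^- 2 * a <= eta / 2.
  have sg0 : 0 < sg by exact: lt_le_trans sg1.
  rewrite mulrC ler_pdivrMr ?exprn_gt0//.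
  have -> : a = eta / 2 * (sg - 1) by rewrite /sg; field; rewrite gt_eqF.
  by rewrite ler_pM2l ?divr_gt0//; nra.
have [M M0 HM] := gaussian_law_chernoff t s0 r0 sg1.
near=> eps; have eps0 : 0 < eps by near: eps; exact: nbhs_right_gt.
have epsM : `|eps * ln M| <= eta / 2.
  by near: eps; apply: near_small_mul; rewrite divr_gt0.
have := HM eps a C eps0 mC CI.
set X := M * _ => muX.
have X0 : 0 < X by rewrite mulr_gt0// expR_gt0.
have lnX : (lne (mu eps C) <= (ln X)%:E)%E.
  by rewrite -lne_EFin// lee_lne// in_itv/= ?leey ?andbT// lee_fin ltW.
apply: (@le_trans _ _ (eps%:E * (ln X)%:E)%E).
  by rewrite lee_pmul2l// ?lte_fin.
rewrite -EFinM lee_fin /X lnM ?posrE ?expR_gt0// expRK.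
have -> : eps * (ln M + - ((1 - sg ^- 2) * (a / eps))) = eps * ln M - a + sg ^- 2 * a.
  by field; rewrite !gt_eqF// (lt_le_trans ltr01).
by move: epsM; rewrite ler_norml => /andP[_ ?]; lra.
Unshelve. all: by end_near. Qed.

(** A box with corner at the preimage of [x] is mapped into [U] when its side [rho] is
    small, and the exponent for that box tends to the rate at [x] with [rho]. *)
Lemma gaussian_law_ldp_lower (U : set (R * R)) x : open U -> U x ->
  ((- I x)%:E <= limf_einf (fun eps : R => eps%:E * lne (mu eps U)) 0^'+)%E.
Proof.
move=> oU Ux; apply: limf_einf_ge_near => eta eta0.
have [y Ly] : exists y, lower_triangular s t r y = x.
  exists (x.1 / s, (x.2 - t * (x.1 / s)) / r).
  by rewrite /lower_triangular/= [RHS]surjective_pairing; congr pair; field; rewrite ?s0 ?r0.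
have oLU : open (lower_triangular s t r @^-1` U).
  by move/continuousP: continuous_lower_triangular; exact.
have /nbhs_ballP[e /= e0 eU] : nbhs y (lower_triangular s t r @^-1` U).
  by apply: open_nbhs_nbhs; split => //=; rewrite Ly.
set K := `|y.1| + `|y.2| + 1.
have K0 : 0 < K by rewrite ltr_wpDl// addr_ge0.
pose rho := Num.min e (Num.min 1 (eta / (2 * K))).
have rho0 : 0 < rho by rewrite !lt_min e0 ltr01 divr_gt0// mulr_gt0.
have [c c0 Hc] := gaussian_law_box s t r y rho0.
set kap := ((`|y.1| + rho) ^+ 2 + (`|y.2| + rho) ^+ 2) / 2 in Hc.
have kapI : kap <= I x + eta / 2.
  have rho1 : rho <= 1 by rewrite !ge_min lexx orbT.
  have rhoK : rho * K <= eta / 2.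
    have -> : eta / 2 = eta / (2 * K) * K by field; rewrite gt_eqF.
    by rewrite ler_pM2r// !ge_min lexx !orbT.
  rewrite -Ly /I gaussian_rateE// /kap.
  rewrite -[y.1 ^+ 2]real_normK ?num_real// -[y.2 ^+ 2]real_normK ?num_real//.
  have : rho ^+ 2 <= rho by rewrite expr2 ler_piMr// ltW.
  by move: rhoK; rewrite /K; lra.
near=> eps; have eps0 : 0 < eps by near: eps; exact: nbhs_right_gt.
have eps1 : eps <= 1 by near: eps; exact: nbhs_right_le.
have lnc : `|eps * ln c| <= eta / 2.
  by near: eps; apply: near_small_mul; rewrite divr_gt0.
have := Hc eps eps0 eps1 U (open_measurable2 oU).
set X := c * _ => muX.
have X0 : 0 < X by rewrite mulr_gt0// expR_gt0.
have lnX : ((ln X)%:E <= lne (mu eps U))%E.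
  rewrite -lne_EFin// lee_lne//.
  - apply: muX => z /andP[z1 z2] /andP[z3 z4]; apply: eU.
    have rhoe : rho <= e by rewrite ge_min lexx.
    by split; rewrite /ball/= ltr_norml; apply/andP; split; clear -z1 z2 z3 z4 rhoe rho0; lra.
  - by rewrite in_itv/= leey andbT lee_fin ltW.
  - by rewrite in_itv/= leey andbT.
apply: (@le_trans _ _ (eps%:E * (ln X)%:E)%E); last by rewrite lee_pmul2l// ?lte_fin.
rewrite -EFinM lee_fin /X lnM ?posrE ?expR_gt0// expRK.
have -> : eps * (ln c - kap / eps) = eps * ln c - kap by field; rewrite gt_eqF.
by move: lnc; rewrite ler_norml => /andP[? _]; lra.
Unshelve. all: by end_near. Qed.

(** Only the case of an infinite infimum of the rate over [C], that is of an empty [C],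
    escapes the upper bound for finite [a]; that bound then holds for every [a]. *)
Lemma gaussian_law_LDP : LDP mu (EFin \o I).
Proof.
have [rI _] := gaussian_rate_good; split => //.
- move=> U oU; rewrite leeNl; apply: le_ereal_inf_tmp => _ [x Ux <-].
  by rewrite leeNl; exact: gaussian_law_ldp_lower.
- move=> C cC.
  have mC : measurable C by rewrite -[C]setCK; apply: measurableC; apply: open_measurable2; rewrite openC.
  have inf0 : (0 <= ereal_inf [set (EFin \o I) x | x in C])%E.
    by apply: le_ereal_inf_tmp => _ [x _ <-]; rewrite lee_fin gaussian_rate_ge0.
  have infC x : C x -> (ereal_inf [set (EFin \o I) x | x in C] <= (I x)%:E)%E.
    by move=> Cx; apply: ereal_inf_lbound; exists x.
  move: inf0 infC; case: ereal_inf => [a||]//.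
    by rewrite lee_fin => a0 infC; apply: gaussian_law_ldp_upper => // x /infC.
  move=> _ infC; rewrite leeNr leye_eq; apply/eqP/eqyP => a a0.
  rewrite leeNr; apply: gaussian_law_ldp_upper => //; first exact: ltW.
  by move=> x /infC.
Qed.

End gaussian_large_deviation_principle.

(** * The stationary covariance of the scheme *)

Section lyapunov.
Context {F : fieldType}.

(** For sequences [u] and [v] solving [x_(n+2) = t x_(n+1) - delta x_n], the sum of
    the products [u_n v_n] in terms of the two initial values of each. *)
Definition recurrence_gram (t delta u0 u1 v0 v1 : F) : F :=
  ((1 + delta) * (u0 * v0 + u1 * v1) - t ^+ 2 * (1 - delta) * (u0 * v0)
   - t * delta * (u0 * v1 + u1 * v0))
  / ((1 - delta) * (1 + delta - t) * (1 + delta + t)).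

Section entries.
Variables a11 a12 a21 a22 b1 b2 : F.
Let t := a11 + a22.
Let delta := a11 * a22 - a12 * a21.
Let u1 := a11 * b1 + a12 * b2.
Let v1 := a21 * b1 + a22 * b2.
Let S11 := recurrence_gram t delta b1 u1 b1 u1.
Let S12 := recurrence_gram t delta b1 u1 b2 v1.
Let S22 := recurrence_gram t delta b2 v1 b2 v1.

(** By Cayley-Hamilton both coordinates of [A ^ n b] solve the recurrence whose
    coefficients are the trace [t] and the determinant [delta] of [A], so [S] is the
    sum of the matrices [A ^ n b b^T (A^T) ^ n] and solves [S = A S A^T + b b^T]. *)
Lemma recurrence_gram_lyapunov : 1 - delta != 0 -> 1 + delta - t != 0 ->
  1 + delta + t != 0 ->
  [/\ S11 = a11 ^+ 2 * S11 + 2 * a11 * a12 * S12 + a12 ^+ 2 * S22 + b1 ^+ 2,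
      S12 = a11 * a21 * S11 + (a11 * a22 + a12 * a21) * S12 + a12 * a22 * S22 + b1 * b2
    & S22 = a21 ^+ 2 * S11 + 2 * a21 * a22 * S12 + a22 ^+ 2 * S22 + b2 ^+ 2].
Proof.
rewrite /S11 /S12 /S22 /recurrence_gram /u1 /v1 /t /delta => h1 h2 h3.
split.
- by field; rewrite h1 h2 h3.
- by field; rewrite h1 h2 h3.
- by field; rewrite h1 h2 h3.
Qed.

Variables l1 l2 : F.
Hypotheses (a12_neq0 : a12 != 0) (tE : l1 + l2 = t) (deltaE : l1 * l2 = delta).
Hypotheses (l1_neq1 : 1 - l1 ^+ 2 != 0) (l2_neq1 : 1 - l2 ^+ 2 != 0)
  (l12_neq1 : 1 - l1 * l2 != 0).

Let a22E : a22 = l1 + l2 - a11.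
Proof. by rewrite tE /t; ring. Qed.

Let a21E : a21 = (a11 - l1) * (l2 - a11) / a12.
Proof.
apply: (mulIf a12_neq0); rewrite divfK//.
transitivity (a11 * a22 - delta); first by rewrite /delta; ring.
by rewrite -deltaE a22E; ring.
Qed.

Let factors : [/\ 1 + l1 != 0, 1 - l1 != 0, 1 + l2 != 0 & 1 - l2 != 0].
Proof.
have e (l : F) : 1 - l ^+ 2 = (1 + l) * (1 - l) by ring.
move: l1_neq1 l2_neq1; rewrite !e !mulf_eq0 !negb_or.
by move=> /andP[-> ->] /andP[-> ->].
Qed.

Let gramE u0 u1' v0 v1' : recurrence_gram t delta u0 u1' v0 v1' =
  ((1 + l1 * l2) * (u0 * v0 + u1' * v1') - (l1 + l2) ^+ 2 * (1 - l1 * l2) * (u0 * v0)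
   - (l1 + l2) * (l1 * l2) * (u0 * v1' + u1' * v0))
  / ((1 - l1 * l2) * ((1 + l1) * (1 - l1) * ((1 + l2) * (1 - l2)))).
Proof.
rewrite /recurrence_gram -tE -deltaE; congr (_ / _); ring.
Qed.

(** The sums of geometric series on the left come from diagonalising [A], and the
    factor on the right is the square of [l1 - l2].  Since [a12 != 0], the entries
    [a22] and [a21] are rational functions of [a11], [a12] and the eigenvalues,
    which leaves an identity between independent variables. *)
Lemma eigenvalue_sum11 :
  (a12 * b2 + b1 * (a11 - l2)) ^+ 2 / (1 - l1 ^+ 2)
  + (a12 * b2 + b1 * (a11 - l1)) ^+ 2 / (1 - l2 ^+ 2)
  + (2 * a12 * a21 * b1 ^+ 2 - 2 * a12 ^+ 2 * b2 ^+ 2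
     + 2 * a12 * b1 * b2 * (a22 - a11)) / (1 - l1 * l2)
  = (t ^+ 2 - 4 * delta) * S11.
Proof.
have [f1 f2 f3 f4] := factors.
rewrite /S11 gramE -tE -deltaE /u1 a21E a22E; field.
by rewrite a12_neq0 l1_neq1 l2_neq1 l12_neq1 f1 f2 f3 f4.
Qed.

Lemma eigenvalue_sum22 :
  (a21 * b1 + b2 * (l1 - a11)) ^+ 2 / (1 - l1 ^+ 2)
  + (a21 * b1 + b2 * (l2 - a11)) ^+ 2 / (1 - l2 ^+ 2)
  + (2 * a12 * a21 * b2 ^+ 2 - 2 * a21 ^+ 2 * b1 ^+ 2
     - 2 * a21 * b1 * b2 * (a22 - a11)) / (1 - l1 * l2)
  = (t ^+ 2 - 4 * delta) * S22.
Proof.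
have [f1 f2 f3 f4] := factors.
rewrite /S22 gramE -tE -deltaE /v1 a21E a22E; field.
by rewrite a12_neq0 l1_neq1 l2_neq1 l12_neq1 f1 f2 f3 f4.
Qed.

Lemma eigenvalue_sum12 :
  (a21 * (a11 - l2) * b1 ^+ 2 + a12 * (l1 - a11) * b2 ^+ 2
   + 2 * a12 * a21 * b1 * b2) / (1 - l1 ^+ 2)
  + (a21 * (a11 - l1) * b1 ^+ 2 + a12 * (l2 - a11) * b2 ^+ 2
     + 2 * a12 * a21 * b1 * b2) / (1 - l2 ^+ 2)
  + ((a22 - a11) * (a21 * b1 ^+ 2 - a12 * b2 ^+ 2 + b1 * b2 * (a22 - a11)))
    / (1 - l1 * l2)
  = (t ^+ 2 - 4 * delta) * S12.
Proof.
have [f1 f2 f3 f4] := factors.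
rewrite /S12 gramE -tE -deltaE /u1 /v1 a21E a22E; field.
by rewrite a12_neq0 l1_neq1 l2_neq1 l12_neq1 f1 f2 f3 f4.
Qed.

End entries.
End lyapunov.

Lemma det_mx2 (R : comNzRingType) (A : 'M[R]_2) : \det A = A 0 0 * A 1 1 - A 0 1 * A 1 0.
Proof.
rewrite (expand_det_row _ 0) !big_ord_recl big_ord0 /cofactor !det_mx11 !mxE /=.
have e (i j k l : 'I_2) : i = k -> j = l -> A i j = A k l by move=> -> ->.
rewrite expr0 expr1 addr0 mul1r mulN1r mulrN.
congr (_ * _ - _ * _); apply: e; exact/val_inj.
Qed.

Lemma mxtrace_mx2 (R : comNzRingType) (A : 'M[R]_2) : \tr A = A 0 0 + A 1 1.
Proof.
by rewrite /mxtrace !big_ord_recl big_ord0 addr0; congr (_ + A _ _); apply/val_inj.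
Qed.

Section covariance.
Context {R : realType}.
Variables (A : 'M[R]_2) (b : 'cV[R]_2).
Local Open Scope complex_scope.

Let t := A 0 0 + A 1 1.
Let delta := A 0 0 * A 1 1 - A 0 1 * A 1 0.
Let u1 := A 0 0 * b 0 0 + A 0 1 * b 1 0.
Let v1 := A 1 0 * b 0 0 + A 1 1 * b 1 0.

Definition lyapunov11 : R := recurrence_gram t delta (b 0 0) u1 (b 0 0) u1.
Definition lyapunov12 : R := recurrence_gram t delta (b 0 0) u1 (b 1 0) v1.
Definition lyapunov22 : R := recurrence_gram t delta (b 1 0) v1 (b 1 0) v1.

Definition lyapunov_det : R := lyapunov11 * lyapunov22 - lyapunov12 ^+ 2.

Let trE : \tr A = t.
Proof. exact: mxtrace_mx2. Qed.

Let detE : \det A = delta.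
Proof. exact: det_mx2. Qed.

Let l1 := lambda1 A.
Let l2 := lambda2 A.

Let lambda_sum : l1 + l2 = (A 0 0)%:C + (A 1 1)%:C.
Proof. by rewrite /l1 /l2 /lambda1 /lambda2 trE /t rmorphD; field. Qed.

Let lambda_prod : l1 * l2 = (A 0 0)%:C * (A 1 1)%:C - (A 0 1)%:C * (A 1 0)%:C.
Proof.
transitivity (((\tr A)%:C ^+ 2 - sqrtc (discr A)%:C ^+ 2) / 4).
  by rewrite /l1 /l2 /lambda1 /lambda2; field.
rewrite sqr_sqrtc /discr detE /delta.
transitivity ((A 0 0 * A 1 1 - A 0 1 * A 1 0)%:C); last by rewrite rmorphB !rmorphM.
rewrite -rmorphXn -rmorphB.
have -> : 4 = (4 : R)%:C by rewrite rmorph_nat.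
by rewrite -fmorphV -rmorphM; congr (_%:C); field.
Qed.

Hypotheses (a12_neq0 : A 0 1 != 0) (d1 : 1 - delta != 0) (d2 : 1 + delta - t != 0)
  (d3 : 1 + delta + t != 0).

Let realC_neq0 (x : R) : x != 0 -> x%:C != 0.
Proof. by move=> x0; rewrite fmorph_eq0. Qed.

Let a12C : (A 0 1)%:C != 0. Proof. exact: realC_neq0. Qed.

Let l12_neq1 : 1 - l1 * l2 != 0.
Proof.
have -> : 1 - l1 * l2 = (1 - delta)%:C.
  by rewrite lambda_prod /delta !(rmorphM, rmorphB, rmorph1).
exact: realC_neq0.
Qed.

Let l1_l2_neq1 : (1 - l1 ^+ 2) * (1 - l2 ^+ 2) != 0.
Proof.
have -> : (1 - l1 ^+ 2) * (1 - l2 ^+ 2) =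
    (1 + l1 * l2 - (l1 + l2)) * (1 + l1 * l2 + (l1 + l2)) by ring.
rewrite lambda_prod lambda_sum.
rewrite (_ : _ * _ = ((1 + delta - t) * (1 + delta + t))%:C); last first.
  by rewrite /delta /t !(rmorphM, rmorphB, rmorphD, rmorph1).
by apply: realC_neq0; rewrite mulf_neq0.
Qed.

Let l1_neq1 : 1 - l1 ^+ 2 != 0.
Proof. by move: l1_l2_neq1; rewrite mulf_eq0 negb_or => /andP[]. Qed.

Let l2_neq1 : 1 - l2 ^+ 2 != 0.
Proof. by move: l1_l2_neq1; rewrite mulf_eq0 negb_or => /andP[]. Qed.

Let recurrence_gramC (x y u v w z : R) : (recurrence_gram x y u v w z)%:C =
  recurrence_gram x%:C y%:C u%:C v%:C w%:C z%:C.
Proof.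
rewrite /recurrence_gram fmorph_div.
by rewrite !(rmorphM, rmorphB, rmorphD, rmorphXn, rmorph1).
Qed.

Let discrC : (discr A)%:C = ((A 0 0)%:C + (A 1 1)%:C) ^+ 2 -
  4 * ((A 0 0)%:C * (A 1 1)%:C - (A 0 1)%:C * (A 1 0)%:C).
Proof.
rewrite /discr trE detE /t /delta.
by rewrite !(rmorphM, rmorphB, rmorphD, rmorphXn, rmorph_nat).
Qed.

Lemma Sigma11E : Sigma11 A b = (discr A * lyapunov11)%:C.
Proof.
transitivity ((discr A)%:C * lyapunov11%:C); last exact/esym/rmorphM.
rewrite discrC recurrence_gramC /u1 /t /delta.
rewrite !(rmorphM, rmorphB, rmorphD).
exact: eigenvalue_sum11.
Qed.

Lemma Sigma22E : Sigma22 A b = (discr A * lyapunov22)%:C.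
Proof.
transitivity ((discr A)%:C * lyapunov22%:C); last exact/esym/rmorphM.
rewrite discrC recurrence_gramC /v1 /t /delta.
rewrite !(rmorphM, rmorphB, rmorphD).
exact: eigenvalue_sum22.
Qed.

Lemma Sigma12E : Sigma12 A b = (discr A * lyapunov12)%:C.
Proof.
transitivity ((discr A)%:C * lyapunov12%:C); last exact/esym/rmorphM.
rewrite discrC recurrence_gramC /u1 /v1 /t /delta.
rewrite !(rmorphM, rmorphB, rmorphD).
exact: eigenvalue_sum12.
Qed.

(** [Sigma] is [discr A] times a real matrix, so the quadratic form has one factor
    [discr A] in front and one inside, which cancel the square in the determinant. *)
Lemma rate_formulaE (h : R) (x : R * R) : discr A != 0 -> h != 0 -> lyapunov_det != 0 ->
  rate_formula A b h x = ((lyapunov22 * x.1 ^+ 2 + lyapunov11 * x.2 ^+ 2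
    - 2 * lyapunov12 * x.1 * x.2) / (2 * h * lyapunov_det))%:C.
Proof.
rewrite /rate_formula Sigma11E Sigma12E Sigma22E /lyapunov_det.
move: (discr A) lyapunov11 lyapunov12 lyapunov22 => D S11 S12 S22 D0 h0 L0.
transitivity ((D * (D * S22 * x.1 ^+ 2 + D * S11 * x.2 ^+ 2 - 2 * (D * S12) * x.1 * x.2) /
    (2 * h * (D * S11 * (D * S22) - (D * S12) ^+ 2)))%:C).
  by rewrite fmorph_div !(rmorphM, rmorphB, rmorphD, rmorphXn, rmorph_nat).
congr (_%:C).
have -> : D * S11 * (D * S22) - (D * S12) ^+ 2 = D ^+ 2 * (S11 * S22 - S12 ^+ 2) by ring.
field; by rewrite ?D0 ?h0 ?L0.
Qed.

End covariance.

(** * Small step sizes *)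

Section right_limits.
Context {R : realType}.

Lemma cvg_id_at_right0 : h @[h --> (0 : R)^'+] --> (0 : R).
Proof. exact/cvg_at_right_filter/cvg_id. Qed.

Lemma right_cvg_linear (f : R -> R) (c k : R) : 0 < k ->
  (\forall h \near 0^'+, `|f h - c| <= k * h) -> f h @[h --> 0^'+] --> c.
Proof.
move=> k0 fc; apply/cvgrPdistC_le => e e0.
near=> h; apply: (@le_trans _ _ (k * h)); first by near: h.
rewrite mulrC -ler_pdivlMr//; near: h; apply: nbhs_right_le.
by rewrite divr_gt0.
Unshelve. all: by end_near. Qed.

End right_limits.

(* The limit must be given as the same polynomial expression in the limits of the
   hypotheses, which is why the limits below are not simplified. *)
Ltac cvg_arith := repeat lazymatch goal with
  | |- context [fmap (fun h => (@?f h * @?g h)%R) _] => refine (@cvgM _ _ _ _ f g _ _ _ _)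
  | |- context [fmap (fun h => (@?f h + @?g h)%R) _] => refine (@cvgD _ (_^o) _ _ _ f g _ _ _ _)
  | |- context [fmap (fun h => (- @?f h)%R) _] => refine (@cvgN _ (_^o) _ _ _ f _ _)
  | |- context [fmap (fun h => h) _] => exact: cvg_id_at_right0
  | |- context [fmap (fun h => ?f h) _] => assumption
  | |- context [fmap (fun h => ?c) _] => exact: cvg_cst
  end.

Section scaled_gram.
Context {F : fieldType}.

(** [recurrence_gram] for the recurrence of [1 + h P] with [T] the trace and [D] the
    determinant of [P], rescaled so that it stays bounded as [h] goes to 0.  Both the
    numerator and the denominator of [recurrence_gram] are small there; the common
    power of [h] is removed by hand, and [x] and [s] stand for [(1 - delta) / h] and
    [1 + delta] in terms of the determinant [delta] of [1 + h P]. *)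
Definition scaled_gram_num (h T D u w v z : F) : F :=
  let x := - (T + h * D) in let s := 2 + h * T + h * h * D in
  u * v * (x * x * s + 2 * (s - 1) * D + D * (2 * s - h * h * D) * (h * x))
  + (u * z + v * w) * (x * s + h * (s - 1) * D) + w * z * s.

Definition scaled_gram_den (h T D : F) : F :=
  - (T + h * D) * D * (4 + 2 * h * T + h * h * D).

Lemma recurrence_gram_scaled (h T D u w v z : F) : h != 0 -> scaled_gram_den h T D != 0 ->
  h * recurrence_gram (2 + h * T) (1 + h * T + h * h * D) u (u + h * w) v (v + h * z) =
  scaled_gram_num h T D u w v z / scaled_gram_den h T D.
Proof.
rewrite /scaled_gram_den !mulf_eq0 !negb_or => h0 /andP[/andP[T0 D0] s0].
rewrite /recurrence_gram /scaled_gram_num.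
have -> : (1 - (1 + h * T + h * h * D)) * (1 + (1 + h * T + h * h * D) - (2 + h * T)) *
    (1 + (1 + h * T + h * h * D) + (2 + h * T)) =
    h ^+ 3 * (- (T + h * D) * D * (4 + 2 * h * T + h * h * D)) by ring.
by field; rewrite ?h0 ?T0 ?D0 ?s0.
Qed.

End scaled_gram.

Section plane_contraction.
Context {R : realType}.

Definition plane_map (M : 'M[R]_2) (x : R * R) : R * R :=
  (M 0 0 * x.1 + M 0 1 * x.2, M 1 0 * x.1 + M 1 1 * x.2).

(** The cross term is what makes the energy of the oscillator decrease strictly: the
    friction acts on [p] only, so that [p ^ 2 + q ^ 2] alone is stationary at [p = 0]. *)
Definition energy (kap : R) (x : R * R) : R := x.1 ^+ 2 + x.2 ^+ 2 + kap * (x.1 * x.2).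

Lemma energy_bounds kap x : 0 <= kap <= 1 ->
  (x.1 ^+ 2 + x.2 ^+ 2) / 2 <= energy kap x <= 2 * (x.1 ^+ 2 + x.2 ^+ 2).
Proof.
move=> /andP[k0 k1]; rewrite /energy.
have h1 : 0 <= (x.1 + x.2) ^+ 2 by exact: sqr_ge0.
have h2 : 0 <= (x.1 - x.2) ^+ 2 by exact: sqr_ge0.
have h3 : 0 <= kap * (x.1 + x.2) ^+ 2 by exact: mulr_ge0.
have h4 : 0 <= kap * (x.1 - x.2) ^+ 2 by exact: mulr_ge0.
have h5 : 0 <= (1 - kap) * (x.1 ^+ 2 + x.2 ^+ 2).
  by rewrite mulr_ge0 ?subr_ge0// addr_ge0 ?sqr_ge0.
by apply/andP; split; lra.
Qed.

(** [w] is the ratio of the determinant to the trace, a lower bound of the smallest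
    eigenvalue. *)
Lemma posdef_lower (c1 c2 c3 : R) : 0 < c1 -> 0 < 4 * c1 * c3 - c2 ^+ 2 ->
  exists2 w : R, 0 < w & forall p q, w * (p ^+ 2 + q ^+ 2) <= c1 * p ^+ 2 + c2 * (p * q) + c3 * q ^+ 2.
Proof.
move=> c10 d0.
have c30 : 0 < c3.
  have : 0 < 4 * c1 * c3 by rewrite (lt_le_trans d0)// gerBl sqr_ge0.
  by rewrite pmulr_rgt0// mulr_gt0.
have s0 : 0 < c1 + c3 by rewrite addr_gt0.
pose w := (4 * c1 * c3 - c2 ^+ 2) / (4 * (c1 + c3)).
have w0 : 0 < w by rewrite divr_gt0// mulr_gt0.
have wE : 4 * w * (c1 + c3) = 4 * c1 * c3 - c2 ^+ 2 by rewrite /w; field; rewrite gt_eqF.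
have wc1 : 0 < c1 - w.
  have : 0 < 4 * (c1 + c3) * (c1 - w).
    have -> : 4 * (c1 + c3) * (c1 - w) = 4 * c1 ^+ 2 + c2 ^+ 2.
      transitivity (4 * (c1 + c3) * c1 - 4 * w * (c1 + c3)); first by ring.
      by rewrite wE; ring.
    by rewrite ltr_wpDr ?sqr_ge0// mulr_gt0// exprn_gt0.
  by rewrite pmulr_rgt0// mulr_gt0.
exists w => // p q; rewrite -subr_ge0.
have : 0 <= 4 * (c1 - w) * (c1 * p ^+ 2 + c2 * (p * q) + c3 * q ^+ 2 - w * (p ^+ 2 + q ^+ 2)).
  have -> : 4 * (c1 - w) * (c1 * p ^+ 2 + c2 * (p * q) + c3 * q ^+ 2 - w * (p ^+ 2 + q ^+ 2)) =
      (2 * (c1 - w) * p + c2 * q) ^+ 2 + (2 * w * q) ^+ 2.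
    transitivity ((2 * (c1 - w) * p + c2 * q) ^+ 2 +
       (4 * c1 * c3 - c2 ^+ 2 - 4 * w * (c1 + c3) + 4 * w ^+ 2) * q ^+ 2); first by ring.
    by rewrite -wE; ring.
  by rewrite addr_ge0 ?sqr_ge0.
by rewrite pmulr_rge0// mulr_gt0.
Qed.

Lemma energy_contraction_iter (M : 'M[R]_2) kap theta : 0 <= kap <= 1 -> 0 <= theta < 1 ->
  (forall x, energy kap (plane_map M x) <= theta * energy kap x) ->
  forall x, exists2 delta : nat -> R, delta @ \oo --> (0 : R) &
    forall n, `|(iter n (plane_map M) x).1| + `|(iter n (plane_map M) x).2| <= delta n.
Proof.
move=> kap01 /andP[th0 th1] contr x.
exists (fun n => Num.sqrt (4 * energy kap x * theta ^+ n)).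
  rewrite -[0](sqrtr0 R) -[X in Num.sqrt X](mulr0 (4 * energy kap x)).
  apply: (cvg_comp _ Num.sqrt); last exact: sqrt_continuous.
  apply: cvgM; first exact: cvg_cst.
  by apply: cvg_expr; rewrite ger0_norm.
move=> n; have en : energy kap (iter n (plane_map M) x) <= theta ^+ n * energy kap x.
  elim: n => [|n IHn]; first by rewrite mul1r.
  by rewrite /= (le_trans (contr _))// exprS -mulrA ler_wpM2l.
set y := iter n _ x in en *.
have /andP[lo _] := energy_bounds y kap01.
rewrite -[leLHS]ger0_norm ?addr_ge0// -sqrtr_sqr ler_wsqrtr//.
have : 0 <= (`|y.1| - `|y.2|) ^+ 2 by exact: sqr_ge0.
rewrite -(real_normK (num_real y.1)) -(real_normK (num_real y.2)) in lo.
by rewrite mulrAC -mulrA; lra.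
Qed.

End plane_contraction.

Section consistent_scheme.
Context {R : realType}.
Variables (nu : R) (A : R -> 'M[R]_2) (b : R -> 'cV[R]_2).
Hypotheses (nu_gt0 : 0 < nu) (nu_neq2 : nu != 2).
Hypothesis hA : (fun h : R => `|A h 0 0 - 1 + nu * h| + `|A h 0 1 + h|
                        + `|A h 1 0 - h| + `|A h 1 1 - 1|)
          =O_ (0^'+) (fun h : R => h ^+ 2).
Hypothesis hb : (fun h : R => `|b h 0 0 - 1| + `|b h 1 0|) =O_ (0^'+) (fun h : R => h).

Let p11 (h : R) := (A h 0 0 - 1) / h.
Let p12 (h : R) := A h 0 1 / h.
Let p21 (h : R) := A h 1 0 / h.
Let p22 (h : R) := (A h 1 1 - 1) / h.
Let b1 (h : R) := b h 0 0.
Let b2 (h : R) := b h 1 0.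

(** Dividing an error [O(h ^ 2)] by [h] leaves one that vanishes; the limits are the
    entries of the drift matrix of the Langevin equation. *)
Lemma generator_cvg : [/\ p11 h @[h --> 0^'+] --> - nu, p12 h @[h --> 0^'+] --> (-1 : R),
  p21 h @[h --> 0^'+] --> (1 : R) & p22 h @[h --> 0^'+] --> (0 : R)].
Proof.
have /eqO_exP[k k0 Hk] := hA.
have bound (f : R -> R) c : (forall h, `|f h - c * h| <= `|A h 0 0 - 1 + nu * h| + `|A h 0 1 + h|
    + `|A h 1 0 - h| + `|A h 1 1 - 1|) -> f h / h @[h --> 0^'+] --> c.
  move=> fc; apply: (right_cvg_linear k0); near=> h.
  have h0 : 0 < h by near: h; exact: nbhs_right_gt.
  have -> : f h / h - c = (f h - c * h) / h by field; rewrite gt_eqF.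
  rewrite normrM [`|h^-1|]gtr0_norm ?invr_gt0// ler_pdivrMr// (le_trans (fc h))//.
  have : `|(`|A h 0 0 - 1 + nu * h| + `|A h 0 1 + h| + `|A h 1 0 - h| + `|A h 1 1 - 1|)|
      <= k * `|h ^+ 2| by near: h; exact: Hk.
  rewrite [`|h ^+ 2|]ger0_norm ?sqr_ge0// expr2 mulrA.
  by apply: le_trans; exact: ler_norm.
have n0 (x : R) : 0 <= `|x| by [].
split; apply: bound => h.
- rewrite mulNr opprK; have := n0 (A h 0 1 + h); have := n0 (A h 1 0 - h).
  by have := n0 (A h 1 1 - 1); lra.
- rewrite mulN1r opprK; have := n0 (A h 0 0 - 1 + nu * h); have := n0 (A h 1 0 - h).
  by have := n0 (A h 1 1 - 1); lra.
- rewrite mul1r; have := n0 (A h 0 1 + h); have := n0 (A h 0 0 - 1 + nu * h).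
  by have := n0 (A h 1 1 - 1); lra.
- rewrite mul0r subr0; have := n0 (A h 0 1 + h); have := n0 (A h 0 0 - 1 + nu * h).
  by have := n0 (A h 1 0 - h); lra.
Unshelve. all: by end_near. Qed.

Lemma noise_cvg : b1 h @[h --> 0^'+] --> (1 : R) /\ b2 h @[h --> 0^'+] --> (0 : R).
Proof.
have /eqO_exP[k k0 Hk] := hb.
have bound (f : R -> R) c : (forall h, `|f h - c| <= `|b h 0 0 - 1| + `|b h 1 0|) ->
    f h @[h --> 0^'+] --> c.
  move=> fc; apply: (right_cvg_linear k0); near=> h.
  have h0 : 0 < h by near: h; exact: nbhs_right_gt.
  rewrite (le_trans (fc h))//.
  have : `|(`|b h 0 0 - 1| + `|b h 1 0|)| <= k * `|h| by near: h; exact: Hk.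
  by rewrite [`|h|]gtr0_norm//; apply: le_trans; exact: ler_norm.
split; apply: bound => h; first by rewrite lerDl.
by rewrite subr0 lerDr.
Unshelve. all: by end_near. Qed.

Let T h := p11 h + p22 h.
Let D h := p11 h * p22 h - p12 h * p21 h.
Let w h := p11 h * b1 h + p12 h * b2 h.
Let z h := p21 h * b1 h + p22 h * b2 h.

Let T_cvg : T h @[h --> 0^'+] --> - nu + 0.
Proof. by have [c11 c12 c21 c22] := generator_cvg; rewrite /T; cvg_arith. Qed.

Let D_cvg : D h @[h --> 0^'+] --> - nu * 0 - (-1) * 1.
Proof. by have [c11 c12 c21 c22] := generator_cvg; rewrite /D; cvg_arith. Qed.

Let w_cvg : w h @[h --> 0^'+] --> - nu * 1 + (-1) * 0.
Proof.
have [c11 c12 c21 c22] := generator_cvg; have [cb1 cb2] := noise_cvg.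
by rewrite /w; cvg_arith.
Qed.

Let z_cvg : z h @[h --> 0^'+] --> 1 * 1 + 0 * (0 : R).
Proof.
have [c11 c12 c21 c22] := generator_cvg; have [cb1 cb2] := noise_cvg.
by rewrite /z; cvg_arith.
Qed.

Let scaled_gram_num_cvg (u v w' z' : R -> R) lu lv lw lz :
  u h @[h --> 0^'+] --> lu -> v h @[h --> 0^'+] --> lv ->
  w' h @[h --> 0^'+] --> lw -> z' h @[h --> 0^'+] --> lz ->
  scaled_gram_num h (T h) (D h) (u h) (w' h) (v h) (z' h) @[h --> 0^'+] -->
  scaled_gram_num 0 (- nu + 0) (- nu * 0 - (-1) * 1) lu lw lv lz.
Proof.
move=> cu cv cw cz; have cT := T_cvg; have cD := D_cvg.
by rewrite /scaled_gram_num; cvg_arith.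
Qed.

Let scaled_gram_den_cvg : scaled_gram_den h (T h) (D h) @[h --> 0^'+] --> 4 * nu.
Proof.
have cT := T_cvg; have cD := D_cvg.
have -> : 4 * nu = scaled_gram_den 0 (- nu + 0) (- nu * 0 - (-1) * 1).
  by rewrite /scaled_gram_den; ring.
by rewrite /scaled_gram_den; cvg_arith.
Qed.

Let scaled_gram_den_neq0 : \forall h \near 0^'+, scaled_gram_den h (T h) (D h) != 0.
Proof.
by apply: (cvgr_neq0 _ scaled_gram_den_cvg); rewrite mulf_neq0// gt_eqF.
Qed.

Let AE h : h != 0 -> [/\ A h 0 0 = 1 + h * p11 h, A h 0 1 = h * p12 h,
  A h 1 0 = h * p21 h & A h 1 1 = 1 + h * p22 h].
Proof. by move=> h0; rewrite /p11 /p12 /p21 /p22; split; field. Qed.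

Let lyapunovE h : h != 0 -> scaled_gram_den h (T h) (D h) != 0 ->
  let den := scaled_gram_den h (T h) (D h) in
  [/\ h * lyapunov11 (A h) (b h) =
        scaled_gram_num h (T h) (D h) (b1 h) (w h) (b1 h) (w h) / den,
      h * lyapunov12 (A h) (b h) =
        scaled_gram_num h (T h) (D h) (b1 h) (w h) (b2 h) (z h) / den
    & h * lyapunov22 (A h) (b h) =
        scaled_gram_num h (T h) (D h) (b2 h) (z h) (b2 h) (z h) / den].
Proof.
move=> h0 den0 den; have [A00 A01 A10 A11] := AE h0.
have tE : A h 0 0 + A h 1 1 = 2 + h * T h by rewrite A00 A11 /T; ring.
have dE : A h 0 0 * A h 1 1 - A h 0 1 * A h 1 0 = 1 + h * T h + h * h * D h.
  by rewrite A00 A11 A01 A10 /T /D; ring.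
have uE : A h 0 0 * b h 0 0 + A h 0 1 * b h 1 0 = b1 h + h * w h.
  by rewrite A00 A01 /w /b1 /b2; ring.
have vE : A h 1 0 * b h 0 0 + A h 1 1 * b h 1 0 = b2 h + h * z h.
  by rewrite A10 A11 /z /b1 /b2; ring.
by rewrite /lyapunov11 /lyapunov12 /lyapunov22 tE dE uE vE !recurrence_gram_scaled.
Qed.

(** The numerators of the three rescaled sums tend to 2, 0 and 2 and their common
    denominator to [4 nu].  The limit of [h S] is the covariance, for [eps = 1], of the
    invariant measure of the Langevin equation. *)
Lemma lyapunov_cvg : [/\ h * lyapunov11 (A h) (b h) @[h --> 0^'+] --> (2 * nu)^-1,
  h * lyapunov12 (A h) (b h) @[h --> 0^'+] --> (0 : R)
  & h * lyapunov22 (A h) (b h) @[h --> 0^'+] --> (2 * nu)^-1].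
Proof.
have [cb1 cb2] := noise_cvg; have cw := w_cvg; have cz := z_cvg.
have den0 : 4 * nu != 0 by rewrite mulf_neq0// gt_eqF.
have lim (f : R -> R) (u v w' z' : R -> R) lu lv lw lz l :
    u h @[h --> 0^'+] --> lu -> v h @[h --> 0^'+] --> lv ->
    w' h @[h --> 0^'+] --> lw -> z' h @[h --> 0^'+] --> lz ->
    scaled_gram_num 0 (- nu + 0) (- nu * 0 - (-1) * 1) lu lw lv lz / (4 * nu) = l ->
    (\forall h \near 0^'+, f h = scaled_gram_num h (T h) (D h) (u h) (w' h) (v h) (z' h)
      / scaled_gram_den h (T h) (D h)) ->
    f h @[h --> 0^'+] --> l.
  move=> cu cv cw' cz' <- fE.
  apply: (cvg_trans (near_eq_cvg _)); last first.
    apply: cvgM; first exact: (scaled_gram_num_cvg cu cv cw' cz').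
    by apply: cvgV den0 scaled_gram_den_cvg.
  by apply: filterS fE => h ->.
have nearE : \forall h \near 0^'+, h != 0 /\ scaled_gram_den h (T h) (D h) != 0.
  near=> h; split; last by near: h; exact: scaled_gram_den_neq0.
  by rewrite gt_eqF//; near: h; exact: nbhs_right_gt.
have nu0 : nu != 0 by rewrite gt_eqF.
split.
- apply: (lim _ _ _ _ _ _ _ _ _ _ cb1 cb1 cw cw).
    by rewrite /scaled_gram_num; field.
  by apply: filterS nearE => h [h0 d0]; have [] := lyapunovE h0 d0.
- apply: (lim _ _ _ _ _ _ _ _ _ _ cb1 cb2 cw cz).
    by rewrite /scaled_gram_num; field.
  by apply: filterS nearE => h [h0 d0]; have [] := lyapunovE h0 d0.
- apply: (lim _ _ _ _ _ _ _ _ _ _ cb2 cb2 cz cz).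
    by rewrite /scaled_gram_num; field.
  by apply: filterS nearE => h [h0 d0]; have [] := lyapunovE h0 d0.
Unshelve. all: by end_near. Qed.

Lemma discr_mx2 (M : 'M[R]_2) : discr M =
  (M 0 0 + M 1 1) ^+ 2 - 4 * (M 0 0 * M 1 1 - M 0 1 * M 1 0).
Proof. by rewrite /discr det_mx2 mxtrace_mx2. Qed.

(** The nondegeneracy conditions that hold for small [h]: each quantity is a power of
    [h] times an expression whose limit is not 0.  For [discr (A h)] that limit is
    [nu ^ 2 - 4]; the last quantity is the pivot required by the change of variables
    in [gaussian_law_step]. *)
Lemma consistent_scheme_near : \forall h \near 0^'+,
  let t := A h 0 0 + A h 1 1 in
  let delta := A h 0 0 * A h 1 1 - A h 0 1 * A h 1 0 in
  [/\ 0 < h, A h 0 1 != 0, discr (A h) != 0 & delta != 0] /\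
  [/\ 1 - delta != 0, 1 + delta - t != 0 & 1 + delta + t != 0] /\
  [/\ 0 < lyapunov11 (A h) (b h), 0 < lyapunov_det (A h) (b h)
    & A h 1 1 * lyapunov11 (A h) (b h) - A h 0 1 * lyapunov12 (A h) (b h) != 0].
Proof.
have [c11 c12 c21 c22] := generator_cvg; have cT := T_cvg; have cD := D_cvg.
have [l11 l12 l22] := lyapunov_cvg.
have nu2 : 0 < (2 * nu)^-1 by rewrite invr_gt0 mulr_gt0.
have discr_lim : T h * T h + - (4 * D h) @[h --> 0^'+] -->
   (- nu + 0) * (- nu + 0) + - (4 * (- nu * 0 - (-1) * 1)) by cvg_arith.
have delta_lim : 1 + h * (T h + h * D h) @[h --> 0^'+] -->
   1 + 0 * ((- nu + 0) + 0 * (- nu * 0 - (-1) * 1)) by cvg_arith.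
have det_lim : h * lyapunov11 (A h) (b h) * (h * lyapunov22 (A h) (b h)) +
    - (h * lyapunov12 (A h) (b h) * (h * lyapunov12 (A h) (b h))) @[h --> 0^'+] -->
    (2 * nu)^-1 * (2 * nu)^-1 + - (0 * 0).
  apply: (@cvgD _ R^o); first exact: (cvgM l11 l22).
  by apply: (@cvgN _ R^o); exact: (cvgM l12 l12).
have piv_lim : (1 + h * p22 h) * (h * lyapunov11 (A h) (b h)) +
    - (h * p12 h * (h * lyapunov12 (A h) (b h))) @[h --> 0^'+] -->
    (1 + 0 * 0) * (2 * nu)^-1 + - (0 * -1 * 0).
  apply: (@cvgD _ R^o); [apply: cvgM l11|apply: (@cvgN _ R^o); apply: cvgM l12]; cvg_arith.
near=> h => t delta.
have h0 : 0 < h by near: h; exact: nbhs_right_gt.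
have hn0 : h != 0 by rewrite gt_eqF.
have [A00 A01 A10 A11] := AE hn0.
have tE : t = 2 + h * T h by rewrite /t A00 A11 /T; ring.
have dE : delta = 1 + h * T h + h * h * D h.
  by rewrite /delta A00 A11 A01 A10 /T /D; ring.
have den0 : scaled_gram_den h (T h) (D h) != 0 by near: h; exact: scaled_gram_den_neq0.
move: (den0); rewrite /scaled_gram_den !mulf_eq0 !negb_or => /andP[/andP[x0 y0] s0].
split; [split => //|split; split].
- by rewrite A01 mulf_neq0//; near: h; apply: (cvgr_neq0 _ c12); rewrite oppr_eq0 oner_eq0.
- have -> : discr (A h) = h * h * (T h * T h + - (4 * D h)).
    by rewrite discr_mx2 -/t -/delta tE dE; ring.
  rewrite !mulf_neq0//; near: h; apply: (cvgr_neq0 _ discr_lim).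
  have -> : (- nu + 0) * (- nu + 0) + - (4 * (- nu * 0 - (-1) * 1)) = (nu - 2) * (nu + 2) by ring.
  by rewrite mulf_neq0 ?subr_eq0// gt_eqF// addr_gt0.
- rewrite dE (_ : _ + _ = 1 + h * (T h + h * D h)); last by ring.
  near: h; apply: (cvgr_neq0 _ delta_lim).
  by rewrite mul0r addr0 oner_eq0.
- rewrite dE (_ : _ - _ = h * - (T h + h * D h)); last by ring.
  by rewrite mulf_neq0.
- rewrite dE tE (_ : _ - _ = h * h * D h); last by ring.
  by rewrite !mulf_neq0.
- have -> : 1 + delta + t = 4 + 2 * h * T h + h * h * D h by rewrite dE tE; ring.
  exact: s0.
- by rewrite -(pmulr_rgt0 _ h0); near: h; exact: (cvgr_gt _ l11).
- rewrite -(pmulr_rgt0 _ (mulr_gt0 h0 h0)).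
  rewrite (_ : _ * _ = h * lyapunov11 (A h) (b h) * (h * lyapunov22 (A h) (b h)) +
    - (h * lyapunov12 (A h) (b h) * (h * lyapunov12 (A h) (b h)))); last first.
    by rewrite /lyapunov_det; ring.
  near: h; apply: (cvgr_gt _ det_lim).
  by rewrite mulr0 oppr0 addr0 mulr_gt0.
- suff : h * (A h 1 1 * lyapunov11 (A h) (b h) - A h 0 1 * lyapunov12 (A h) (b h)) != 0.
    by rewrite mulf_eq0 negb_or => /andP[].
  have -> : h * (A h 1 1 * lyapunov11 (A h) (b h) - A h 0 1 * lyapunov12 (A h) (b h)) =
      (1 + h * p22 h) * (h * lyapunov11 (A h) (b h)) +
      - (h * p12 h * (h * lyapunov12 (A h) (b h))) by rewrite A11 A01; ring.
  near: h; apply: (cvgr_neq0 _ piv_lim).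
  by rewrite !(mul0r, mulr0, oppr0, addr0) mul1r gt_eqF.
Unshelve. all: by end_near. Qed.

(** The energy [p ^ 2 + q ^ 2 + kap p q] is a Lyapunov function of the damped
    oscillator [p' = - q - nu p], [q' = p], and the scheme inherits its decay. *)
Lemma consistent_scheme_contracts : exists2 kap : R, 0 <= kap <= 1 &
  \forall h \near 0^'+, exists2 theta : R, 0 <= theta < 1 &
    forall x, energy kap (plane_map (A h) x) <= theta * energy kap x.
Proof.
have [c11 c12 c21 c22] := generator_cvg.
have nu4 : 0 < 4 + nu ^+ 2 by rewrite ltr_wpDr ?sqr_ge0.
(* Along the flow the energy decreases at the rate
   [(2 nu - kap) p ^ 2 + kap nu p q + kap q ^ 2], which is positive definite for [kap]
   between 0 and [8 nu / (4 + nu ^ 2)]; this is the midpoint. *)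
pose kap := 4 * nu / (4 + nu ^+ 2).
have kap0 : 0 < kap by rewrite divr_gt0// mulr_gt0.
have kap1 : kap <= 1.
  rewrite ler_pdivrMr// mul1r -subr_ge0.
  have -> : 4 + nu ^+ 2 - 4 * nu = (nu - 2) ^+ 2 by ring.
  exact: sqr_ge0.
have kapE : kap * (4 + nu ^+ 2) = 4 * nu by rewrite /kap divfK// gt_eqF.
exists kap; first by rewrite ltW.
pose c1 h := - (2 * p11 h + kap * p21 h)
  + - (h * (p11 h * p11 h + p21 h * p21 h + kap * (p11 h * p21 h))).
pose c3 h := - (2 * p22 h + kap * p12 h)
  + - (h * (p12 h * p12 h + p22 h * p22 h + kap * (p12 h * p22 h))).
pose c2 h := - (2 * p12 h + 2 * p21 h + kap * (p22 h + p11 h))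
  + - (h * (2 * (p11 h * p12 h) + 2 * (p21 h * p22 h)
            + kap * (p11 h * p22 h + p12 h * p21 h))).
have c1_cvg : c1 h @[h --> 0^'+] --> - (2 * - nu + kap * 1)
    + - (0 * (- nu * - nu + 1 * 1 + kap * (- nu * 1))) by rewrite /c1; cvg_arith.
have c3_cvg : c3 h @[h --> 0^'+] --> - (2 * 0 + kap * -1)
    + - (0 * (-1 * -1 + 0 * 0 + kap * (-1 * 0))) by rewrite /c3; cvg_arith.
have c2_cvg : c2 h @[h --> 0^'+] --> - (2 * -1 + 2 * 1 + kap * (0 + - nu))
    + - (0 * (2 * (- nu * -1) + 2 * (1 * 0) + kap * (- nu * 0 + -1 * 1))).
  by rewrite /c2; cvg_arith.
have d_cvg : 4 * c1 h * c3 h + - (c2 h * c2 h) @[h --> 0^'+] --> 4 * kap * nu.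
  suff -> : 4 * kap * nu = 4 * (- (2 * - nu + kap * 1)
      + - (0 * (- nu * - nu + 1 * 1 + kap * (- nu * 1)))) * (- (2 * 0 + kap * -1)
      + - (0 * (-1 * -1 + 0 * 0 + kap * (-1 * 0)))) + - ((- (2 * -1 + 2 * 1 + kap * (0 + - nu))
      + - (0 * (2 * (- nu * -1) + 2 * (1 * 0) + kap * (- nu * 0 + -1 * 1)))) *
      (- (2 * -1 + 2 * 1 + kap * (0 + - nu))
      + - (0 * (2 * (- nu * -1) + 2 * (1 * 0) + kap * (- nu * 0 + -1 * 1))))).
    clear - c1_cvg c2_cvg c3_cvg; clearbody c1 c2 c3; cvg_arith.
  transitivity (8 * kap * nu - kap * (kap * (4 + nu ^+ 2))); last by ring.
  by rewrite kapE; ring.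
near=> h.
have h0 : 0 < h by near: h; exact: nbhs_right_gt.
have [A00 A01 A10 A11] := AE (lt0r_neq0 h0).
have c10 : 0 < c1 h.
  near: h; apply: (cvgr_gt _ c1_cvg).
  rewrite mul0r oppr0 addr0 mulr1 mulrN opprD opprK subr_gt0.
  by rewrite ltr_pdivrMr// -subr_gt0 (_ : _ - _ = 4 * nu + 2 * nu * nu ^+ 2);
    [rewrite addr_gt0// !mulr_gt0// exprn_gt0|ring].
have d0 : 0 < 4 * c1 h * c3 h - c2 h ^+ 2.
  rewrite expr2; near: h; apply: (cvgr_gt _ d_cvg).
  by apply: mulr_gt0 => //; exact: mulr_gt0.
have [g g0 Hg] := posdef_lower c10 d0.
have energyE x : energy kap (plane_map (A h) x) = energy kap x -
    h * (c1 h * x.1 ^+ 2 + c2 h * (x.1 * x.2) + c3 h * x.2 ^+ 2).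
  by rewrite /energy /plane_map A00 A01 A10 A11 /c1 /c2 /c3 /=; ring.
have kap01 : 0 <= kap <= 1 by rewrite ltW.
have decay x : energy kap (plane_map (A h) x) <= (1 - h * g / 2) * energy kap x.
  rewrite energyE [leRHS]mulrBl mul1r lerD2l lerN2.
  have /andP[_ up] := energy_bounds x kap01.
  apply: (@le_trans _ _ (h * (g * (x.1 ^+ 2 + x.2 ^+ 2)))); last by rewrite ler_pM2l.
  have -> : h * g / 2 * energy kap x = h * (g * (energy kap x / 2)) by field.
  by rewrite !ler_pM2l// ler_pdivrMr// mulrC.
exists (1 - h * g / 2) => //; apply/andP; split.
  have := decay (1, 0); rewrite {2}/energy /= expr0n expr1n !(mulr0, addr0, mulr1).
  apply: le_trans; have /andP[lo _] := energy_bounds (plane_map (A h) (1, 0)) kap01.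
  by apply: le_trans lo; rewrite divr_ge0// addr_ge0 ?sqr_ge0.
by rewrite ltrBlDr ltrDl divr_gt0// mulr_gt0.
Unshelve. all: by end_near. Qed.

End consistent_scheme.

(** * The scheme driven by a Wiener process *)

Section centered_normal.
Context {R : realType}.
Local Notation leb := (@lebesgue_measure R).

Let measurable_scale (sg : R) : measurable_fun setT (fun z : R => sg * z).
Proof. exact: measurable_funM. Qed.

Definition scale (sg : R) : {mfun R >-> R} := mfun_Sub (mem_set (measurable_scale sg)).

Definition centered_normal (sg : R) : probability R R := distribution gauss (scale sg).

Lemma centered_normalE (sg : R) B : 0 < sg -> measurable B ->
  centered_normal sg B = normal_prob 0 sg B.
Proof.
move=> sg0 mB; have sgn0 : sg != 0 by rewrite gt_eqF.
have mk (m s : R) : measurable_fun setT (fun z => (normal_pdf m s z)%:E).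
  by apply/measurable_EFinP; exact: measurable_normal_pdf.
have m1 : measurable_fun setT (fun z : R => (\1_B z)%:E : \bar R).
  by apply/measurable_EFinP; exact: measurable_indic.
transitivity (\int[leb]_z ((\1_B z)%:E * (normal_pdf 0 sg z)%:E))%E; last first.
  rewrite /normal_prob [RHS]integral_mkcond; apply: eq_integral => z _.
  by rewrite patchE indicE; case: (z \in B); rewrite ?mul1e ?mul0e.
rewrite (@ge0_integral_affine _ sg 0)//; last 2 first.
- exact: emeasurable_funM.
- by move=> z; rewrite mule_ge0// lee_fin normal_pdf_ge0.
rewrite -ge0_integralZl//; last 2 first.
- have maff : measurable_fun setT (fun z : R => sg * z + 0) by apply: measurable_funD.
  exact: (measurableT_comp (emeasurable_funM m1 (mk 0 sg)) maff).
- by move=> z _; rewrite mule_ge0// lee_fin normal_pdf_ge0.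
transitivity (\int[gauss]_z (\1_(scale sg @^-1` B) z)%:E)%E.
  have mB' : measurable (scale sg @^-1` B).
    by rewrite -[_ @^-1` _]setTI; exact: measurable_scale.
  transitivity (gauss (scale sg @^-1` B)); first by [].
  by rewrite (integral_indic gauss measurableT mB') setIT.
rewrite ge0_integral_gauss//; last 1 first.
  by apply: (measurableT_comp m1); exact: measurable_scale.
apply: eq_integral => z _; rewrite addr0 muleCA; congr (_ * _)%E.
rewrite -EFinM; congr EFin; rewrite !normal_pdfE ?oner_eq0//.
rewrite [RHS]mulrA -(normal_peak_scale sgn0) (gtr0_norm sg0); congr (_ * expR _).
by field.
Qed.

End centered_normal.

Section gaussian_step.
Context {R : realType}.
Variables (M : 'M[R]_2) (b : 'cV[R]_2).

Definition noisy_step (eps : R) (x : (R * R) * R) : R * R :=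
  (M 0 0 * x.1.1 + M 0 1 * x.1.2 + Num.sqrt eps * b 0 0 * x.2,
   M 1 0 * x.1.1 + M 1 1 * x.1.2 + Num.sqrt eps * b 1 0 * x.2).

Lemma measurable_noisy_step eps : measurable_fun setT (noisy_step eps).
Proof.
have m3 (p q c : R) : measurable_fun setT
    (fun x : (R * R) * R => p * x.1.1 + q * x.1.2 + c * x.2).
  by apply: measurable_funD; [apply: measurable_funD|]; apply: measurable_funM => //;
    exact: measurableT_comp.
by apply/measurable_fun_pairP; split; exact: m3.
Qed.

Variables (s t r sg : R).
Hypotheses (s0 : s != 0) (r0 : r != 0) (sg_gt0 : 0 < sg).
Hypothesis lyap11 : s ^+ 2 = M 0 0 ^+ 2 * s ^+ 2 + 2 * M 0 0 * M 0 1 * (s * t)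
  + M 0 1 ^+ 2 * (t ^+ 2 + r ^+ 2) + sg ^+ 2 * b 0 0 ^+ 2.
Hypothesis lyap12 : s * t = M 0 0 * M 1 0 * s ^+ 2
  + (M 0 0 * M 1 1 + M 0 1 * M 1 0) * (s * t)
  + M 0 1 * M 1 1 * (t ^+ 2 + r ^+ 2) + sg ^+ 2 * (b 0 0 * b 1 0).
Hypothesis lyap22 : t ^+ 2 + r ^+ 2 = M 1 0 ^+ 2 * s ^+ 2 + 2 * M 1 0 * M 1 1 * (s * t)
  + M 1 1 ^+ 2 * (t ^+ 2 + r ^+ 2) + sg ^+ 2 * b 1 0 ^+ 2.
Hypotheses (det0 : M 0 0 * M 1 1 - M 0 1 * M 1 0 != 0) (piv0 : M 1 1 * s - M 0 1 * t != 0).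

(** In the coordinates given by the Cholesky factor [L] of the covariance, one step
    of the scheme is [p |-> (L^-1 M L) p + z (sg L^-1 b)]; the Lyapunov equation says
    exactly that the rows of this [2 x 3] matrix are orthonormal. *)
Lemma gaussian_law_step eps D : 0 < eps -> measurable D ->
  let mu := gaussian_law (Num.sqrt eps * s) (Num.sqrt eps * t) (Num.sqrt eps * r) in
  (mu \x centered_normal sg)%E (noisy_step eps @^-1` D) = mu D.
Proof.
move=> eps0 mD mu; set q := Num.sqrt eps in mu *.
have q0 : q != 0 by rewrite gt_eqF// sqrtr_gt0.
set L := lower_triangular (q * s) (q * t) (q * r).
have mL : measurable_fun setT L by exact: measurable_lower_triangular.
have mstep := measurable_noisy_step eps.
have mgD : measurable (noisy_step eps @^-1` D) by rewrite -[_ @^-1` _]setTI; exact: mstep.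
have mLD : measurable (L @^-1` D) by rewrite -[_ @^-1` _]setTI; exact: mL.
pose F (x : R * R) : \bar R := (\1_D (L x))%:E.
have m1D : measurable_fun setT (fun x => (\1_D x)%:E : \bar R).
  by apply/measurable_EFinP; exact: measurable_indic.
have mF : measurable_fun setT F by exact: (measurableT_comp m1D mL).
have -> : mu D = (\int[gauss2]_x F x)%E.
  transitivity (gauss2 (L @^-1` D)); first by [].
  by rewrite -[LHS]/(gauss2 _) -(setIT (L @^-1` D)) -integral_indic.
transitivity (\int[mu \x centered_normal sg]_x (\1_(noisy_step eps @^-1` D) x)%:E)%E.
  by rewrite (integral_indic (mu \x centered_normal sg)%E measurableT mgD) setIT.
have mstepD : measurable_fun setT
    (fun x => (\1_(noisy_step eps @^-1` D) x)%:E : \bar R).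
  by apply/measurable_EFinP; exact: measurable_indic.
rewrite (fubini_tonelli2 (m1 := mu) (m2 := centered_normal sg))//.
have mG1 : measurable_fun setT (fubini_G mu
    (fun x => (\1_(noisy_step eps @^-1` D) x)%:E : \bar R)).
  exact: measurable_fun_fubini_tonelli_G.
rewrite ge0_integral_distribution//; last first.
  by move=> z; apply: integral_ge0 => x _; rewrite lee_fin.
(* the rows of [L^-1 (M L | sg b)] *)
pose a1 := (M 0 0 * s + M 0 1 * t) / s; pose a2 := M 0 1 * r / s; pose a3 := sg * b 0 0 / s.
pose e1 := (M 1 0 * s + M 1 1 * t - t * a1) / r; pose e2 := (M 1 1 * r - t * a2) / r.
pose e3 := (sg * b 1 0 - t * a3) / r.
have rows11 : a1 ^+ 2 + a2 ^+ 2 + a3 ^+ 2 = 1.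
  rewrite -[RHS](divff (expf_neq0 2 s0)) /a1 /a2 /a3.
  transitivity ((M 0 0 ^+ 2 * s ^+ 2 + 2 * M 0 0 * M 0 1 * (s * t)
    + M 0 1 ^+ 2 * (t ^+ 2 + r ^+ 2) + sg ^+ 2 * b 0 0 ^+ 2) / s ^+ 2); first by field.
  by rewrite -lyap11.
pose f1 := M 1 0 * s + M 1 1 * t; pose f2 := M 1 1 * r; pose f3 := sg * b 1 0.
have rows12' : a1 * f1 + a2 * f2 + a3 * f3 = t.
  rewrite /a1 /a2 /a3 /f1 /f2 /f3.
  transitivity ((M 0 0 * M 1 0 * s ^+ 2 + (M 0 0 * M 1 1 + M 0 1 * M 1 0) * (s * t)
    + M 0 1 * M 1 1 * (t ^+ 2 + r ^+ 2) + sg ^+ 2 * (b 0 0 * b 1 0)) / s); first by field.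
  by rewrite -lyap12; field.
have rows22' : f1 ^+ 2 + f2 ^+ 2 + f3 ^+ 2 = t ^+ 2 + r ^+ 2.
  by rewrite [RHS]lyap22 /f1 /f2 /f3; ring.
have eE : [/\ e1 = (f1 - t * a1) / r, e2 = (f2 - t * a2) / r & e3 = (f3 - t * a3) / r] by [].
have [rows12 rows22] : a1 * e1 + a2 * e2 + a3 * e3 = 0 /\ e1 ^+ 2 + e2 ^+ 2 + e3 ^+ 2 = 1.
  case: eE => -> -> ->; move: rows11 rows12' rows22'.
  clear - r0; move: a1 a2 a3 f1 f2 f3 => a1 a2 a3 f1 f2 f3 h11 h12 h22; split.
    transitivity (((a1 * f1 + a2 * f2 + a3 * f3) - t * (a1 ^+ 2 + a2 ^+ 2 + a3 ^+ 2)) / r).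
      by field.
    by rewrite h11 h12 mulr1 subrr mul0r.
  transitivity (((f1 ^+ 2 + f2 ^+ 2 + f3 ^+ 2) - 2 * t * (a1 * f1 + a2 * f2 + a3 * f3)
    + t ^+ 2 * (a1 ^+ 2 + a2 ^+ 2 + a3 ^+ 2)) / r ^+ 2); first by field.
  by rewrite h11 h12 h22; field.
have detE : a1 * e2 - a2 * e1 = M 0 0 * M 1 1 - M 0 1 * M 1 0.
  by rewrite /e2 /e1 /a1 /a2; field; rewrite s0 r0.
have e2E : e2 = (M 1 1 * s - M 0 1 * t) / s.
  by rewrite /e2 /a2; field; rewrite s0 r0.
have e20 : e2 != 0 by rewrite e2E mulf_neq0// invr_neq0.
have det0' : a1 * e2 - a2 * e1 != 0 by rewrite detE.
have F0 x : (0 <= F x)%E by rewrite lee_fin.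
rewrite [RHS](gauss2_orthonormal rows11 rows22 rows12 det0' e20 mF F0).
apply: eq_integral => z _.
rewrite /= /fubini_G [LHS]ge0_integral_distribution; last 2 first.
- exact: (measurableT_comp mstepD (measurable_pair2 _)).
- by move=> x; rewrite lee_fin.
apply: eq_integral => p _; rewrite /F.
have -> : L (a1 * p.1 + a2 * p.2 + a3 * z, e1 * p.1 + e2 * p.2 + e3 * z) =
    noisy_step eps (L p, scale sg z).
  rewrite /L /lower_triangular /noisy_step /= -/q /e1 /e2 /e3 /a1 /a2 /a3.
  by congr pair; field; rewrite ?s0 ?r0.
by [].
Qed.

End gaussian_step.

Section invariant_integral.
Context {R : realType} d (T : measurableType d) (P : probability T R).
Context d' (S : measurableType d') (mu : probability S R) (G : probability R R).
Variables (Y : nat -> T -> R) (g : S * R -> S).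
Hypotheses (mY : forall i, measurable_fun setT (Y i)) (mg : measurable_fun setT g).
Hypothesis lawY : forall i B, measurable B -> P (Y i @^-1` B) = G B.
Hypothesis indepY : forall n, mutually_independent P Y n.
Hypothesis muG : forall D, measurable D -> (mu \x G)%E (g @^-1` D) = mu D.

Lemma recursion_invariant (phi : S -> R) (c : R) n :
  measurable_fun setT phi -> (forall x, `|phi x| <= c) ->
  (\int[mu]_x 'E_P[fun w => phi (recursion Y g x n w)] = \int[mu]_x (phi x)%:E)%E.
Proof.
move=> mphi phic.
pose X : {mfun (S * T)%type >-> S} := mfun_Sub (mem_set (measurable_recursion mY mg n)).
have mphiE : measurable_fun setT (EFin \o phi) by exact/measurable_EFinP.
have mphiX : measurable_fun setT ((EFin \o phi) \o X).
  by apply: measurableT_comp => //; exact: measurable_recursion.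
have iphiX : (mu \x P)%E.-integrable setT ((EFin \o phi) \o X).
  by apply: (@probability_integrable _ _ _ (mu \x P)%E _ c) => // z; rewrite lee_fin.
transitivity (\int[mu]_x \int[P]_w (phi (recursion Y g x n w))%:E)%E.
  by apply: eq_integral => x _; rewrite unlock.
transitivity (\int[mu \x P]_z ((EFin \o phi) \o X) z)%E.
  exact: (integral12_prod_meas1 iphiX).
rewrite -(integral_distribution (P := (mu \x P)%E) (X := X))//.
apply: eq_measure_integral => D mD _.
exact: (recursion_stationary mY mg lawY indepY muG n mD).
Qed.

End invariant_integral.

Section wiener_chain.
Context {R : realType} d (T : measurableType d) (P : probability T R).
Variables (W : R -> T -> R) (hW : standard_wiener P W).
Variables (A : 'M[R]_2) (b : 'cV[R]_2) (h eps : R).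
Hypothesis h0 : 0 < h.

Let Y (i : nat) (w : T) : R := W (i.+1%:R * h) w - W (i%:R * h) w.

Lemma chain_recursion x n w :
  chain W A b h eps x n w = recursion Y (noisy_step A b eps) x n w.
Proof. by elim: n => [//|n /= ->]; case: (recursion Y (noisy_step A b eps) x n w). Qed.

Let time_ge0 (i : nat) : 0 <= i%:R * h. Proof. by rewrite mulr_ge0// ltW. Qed.

Lemma measurable_increment i : measurable_fun setT (Y i).
Proof. by apply: measurable_funB; apply: (wiener_measurable hW); exact: time_ge0. Qed.

Lemma law_increment i B : measurable B ->
  P (Y i @^-1` B) = centered_normal (Num.sqrt h) B.
Proof.
move=> mB; rewrite centered_normalE ?sqrtr_gt0//.
have -> : h = i.+1%:R * h - i%:R * h by rewrite -mulrBl -natr1 addrAC subrr add0r mul1r.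
rewrite -(wiener_gaussian hW)//; last by rewrite ltr_pM2r// ltr_nat.
Qed.

Lemma independent_increments n : mutually_independent P Y n.
Proof.
apply: (wiener_independent hW (t := fun i => i%:R * h)) => // i j ij.
by rewrite ler_pM2r// ler_nat.
Qed.

Lemma gaussian_law_invariant (s t r : R) : 0 < eps -> s != 0 -> r != 0 ->
  s ^+ 2 = A 0 0 ^+ 2 * s ^+ 2 + 2 * A 0 0 * A 0 1 * (s * t)
    + A 0 1 ^+ 2 * (t ^+ 2 + r ^+ 2) + h * b 0 0 ^+ 2 ->
  s * t = A 0 0 * A 1 0 * s ^+ 2 + (A 0 0 * A 1 1 + A 0 1 * A 1 0) * (s * t)
    + A 0 1 * A 1 1 * (t ^+ 2 + r ^+ 2) + h * (b 0 0 * b 1 0) ->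
  t ^+ 2 + r ^+ 2 = A 1 0 ^+ 2 * s ^+ 2 + 2 * A 1 0 * A 1 1 * (s * t)
    + A 1 1 ^+ 2 * (t ^+ 2 + r ^+ 2) + h * b 1 0 ^+ 2 ->
  A 0 0 * A 1 1 - A 0 1 * A 1 0 != 0 -> A 1 1 * s - A 0 1 * t != 0 ->
  invariant_measure P W A b h eps
    (gaussian_law (Num.sqrt eps * s) (Num.sqrt eps * t) (Num.sqrt eps * r)).
Proof.
rewrite -{1 2 3}(sqr_sqrtr (ltW h0)) => eps0 s0 r0 l11 l12 l22 d0 piv0 phi n cphi [M [_ bphi]].
have phiM x : `|phi x| <= M + 1 by apply: bphi => //; rewrite ltrDl.
under eq_integral => x _.
  rewrite (_ : (fun w => _) = fun w => phi (recursion Y (noisy_step A b eps) x n w)); last first.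
    by apply/funext => w; rewrite chain_recursion.
  over.
apply: (@recursion_invariant _ _ _ P _ _ _ (centered_normal (Num.sqrt h)) Y _ _ _ _ _ _ phi (M + 1) n) => //.
- exact: measurable_increment.
- exact: measurable_noisy_step.
- exact: law_increment.
- exact: independent_increments.
- move=> D mD; apply: gaussian_law_step => //.
- exact: continuous_measurable2.
Qed.

(** The noise cancels in the difference of two trajectories, which therefore obeys
    the recursion without noise. *)
Lemma chain_difference x n w :
  chain W A b h eps x n w = chain W A b h eps 0 n w + iter n (plane_map A) x.
Proof.
elim: n => [|n]; first by rewrite /= add0r.
rewrite /=; case: (chain W A b h eps x n w) => p q.
case: (chain W A b h eps 0 n w) => p' q'.
case: (iter n (plane_map A) x) => u v [-> ->].
by congr pair; rewrite /plane_map/=; ring.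
Qed.

Lemma invariant_measure_unique (kap theta : R) (mu mu' : probability (R * R)%type R) :
  0 <= kap <= 1 -> 0 <= theta < 1 ->
  (forall x, energy kap (plane_map A x) <= theta * energy kap x) ->
  invariant_measure P W A b h eps mu -> invariant_measure P W A b h eps mu' ->
  forall B, measurable B -> mu' B = mu B.
Proof.
move=> kap01 theta01 contr inv inv'.
apply: (coupled_invariant_unique (P := P) (X := fun n x w => chain W A b h eps x n w)) => //.
- move=> n; rewrite (_ : (fun z => _) =
    fun z => recursion Y (noisy_step A b eps) z.1 n z.2).
    apply: measurable_recursion; first exact: measurable_increment.
    exact: measurable_noisy_step.
  by apply/funext => z; rewrite chain_recursion.
- move=> x; have [delta d0 dle] := energy_contraction_iter kap01 theta01 contr x.
  exists delta => // n w; rewrite chain_difference.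
  have addKr' (u v : R) : u + v - u = v by ring.
  by rewrite /= !addKr'.
Qed.

End wiener_chain.

Section scheme_at_fixed_step.
Context {R : realType} d (T : measurableType d) (P : probability T R).
Variables (W : R -> T -> R) (hW : standard_wiener P W).
Variables (A : 'M[R]_2) (b : 'cV[R]_2) (h : R).

Let t := A 0 0 + A 1 1.
Let delta := A 0 0 * A 1 1 - A 0 1 * A 1 0.
Hypotheses (h0 : 0 < h) (a12_neq0 : A 0 1 != 0) (discr_neq0 : discr A != 0)
  (det_neq0 : delta != 0).
Hypotheses (d1 : 1 - delta != 0) (d2 : 1 + delta - t != 0) (d3 : 1 + delta + t != 0).
Hypotheses (S11_gt0 : 0 < lyapunov11 A b) (detS_gt0 : 0 < lyapunov_det A b)
  (piv_neq0 : A 1 1 * lyapunov11 A b - A 0 1 * lyapunov12 A b != 0).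

Let hn0 : h != 0. Proof. by rewrite gt_eqF. Qed.
Let S11n0 : lyapunov11 A b != 0. Proof. by rewrite gt_eqF. Qed.
Let detSn0 : lyapunov_det A b != 0. Proof. by rewrite gt_eqF. Qed.

Lemma rate_formula_real x : rate_formula A b h x = (Ih A b h x)%:C%C.
Proof. by rewrite /Ih rate_formulaE. Qed.

Lemma IhE x : Ih A b h x = (lyapunov22 A b * x.1 ^+ 2 + lyapunov11 A b * x.2 ^+ 2
    - 2 * lyapunov12 A b * x.1 * x.2) / (2 * h * lyapunov_det A b).
Proof. by rewrite /Ih rate_formulaE. Qed.

(* The Cholesky factor of [h S]. *)
Let s := Num.sqrt (h * lyapunov11 A b).
Let c := h * lyapunov12 A b / s.
Let r := Num.sqrt (h * lyapunov_det A b / lyapunov11 A b).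

Let s_gt0 : 0 < s. Proof. by rewrite sqrtr_gt0 mulr_gt0. Qed.
Let r_gt0 : 0 < r. Proof. by rewrite sqrtr_gt0 divr_gt0// mulr_gt0. Qed.
Let s_neq0 : s != 0. Proof. by rewrite gt_eqF. Qed.
Let r_neq0 : r != 0. Proof. by rewrite gt_eqF. Qed.

Let ssE : s ^+ 2 = h * lyapunov11 A b.
Proof. by rewrite sqr_sqrtr// ltW// mulr_gt0. Qed.

Let scE : s * c = h * lyapunov12 A b.
Proof. by rewrite /c mulrC divfK. Qed.

Let rrE : r ^+ 2 = h * lyapunov_det A b / lyapunov11 A b.
Proof. by rewrite sqr_sqrtr// ltW// divr_gt0// mulr_gt0. Qed.

Let ccrrE : c ^+ 2 + r ^+ 2 = h * lyapunov22 A b.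
Proof.
have -> : c ^+ 2 = (s * c) ^+ 2 / s ^+ 2 by field.
rewrite scE ssE rrE /lyapunov_det.
by field; rewrite hn0 S11n0.
Qed.

(** Both sides are the quadratic form of [(h S)^-1 / 2]. *)
Lemma Ih_gaussian_rate x : Ih A b h x = gaussian_rate s c r x.
Proof.
rewrite IhE /gaussian_rate.
transitivity ((x.1 ^+ 2 / s ^+ 2 + (x.2 - s * c * (x.1 / s ^+ 2)) ^+ 2 / r ^+ 2) / 2); last first.
  by field; rewrite s_neq0 r_neq0.
rewrite scE ssE rrE /lyapunov_det; move: detSn0; rewrite /lyapunov_det => dn0.
by field; rewrite ?hn0 ?S11n0 ?dn0.
Qed.

Lemma scheme_large_deviations (kap theta : R) : 0 <= kap <= 1 -> 0 <= theta < 1 ->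
  (forall x, energy kap (plane_map A x) <= theta * energy kap x) ->
  exists mu : R -> probability (R * R)%type R,
    [/\ forall eps, 0 < eps -> unique_invariant_measure P W A b h eps (mu eps),
        good_rate_function (EFin \o Ih A b h)
      & LDP mu (EFin \o Ih A b h)].
Proof.
move=> kap01 theta01 contr.
have -> : Ih A b h = gaussian_rate s c r by apply/funext => x; exact: Ih_gaussian_rate.
exists (fun eps => gaussian_law (Num.sqrt eps * s) (Num.sqrt eps * c) (Num.sqrt eps * r)).
split; [|exact: gaussian_rate_good|exact: gaussian_law_LDP].
move=> eps eps0.
have inv : invariant_measure P W A b h eps
    (gaussian_law (Num.sqrt eps * s) (Num.sqrt eps * c) (Num.sqrt eps * r)).
  have [l11 l12 l22] := recurrence_gram_lyapunov (b 0 0) (b 1 0) d1 d2 d3.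
  rewrite -/(lyapunov11 A b) -/(lyapunov12 A b) -/(lyapunov22 A b) in l11 l12 l22.
  apply: gaussian_law_invariant => //.
  - by rewrite ssE scE ccrrE {1}l11; ring.
  - by rewrite ssE scE ccrrE {1}l12; ring.
  - by rewrite ssE scE ccrrE {1}l22; ring.
  - have -> : A 1 1 * s - A 0 1 * c =
        h * (A 1 1 * lyapunov11 A b - A 0 1 * lyapunov12 A b) / s.
      transitivity ((A 1 1 * s ^+ 2 - A 0 1 * (s * c)) / s); first by field.
      by rewrite ssE scE; field.
    by rewrite mulf_neq0 ?invr_neq0// mulf_neq0.
split=> // mu' inv' B mB.
exact: (invariant_measure_unique hW h0 kap01 theta01 contr inv inv').
Qed.

End scheme_at_fixed_step.

Theorem theorem4p6 (R : realType) (d : measure_display) (T : measurableType d)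
    (P : probability T R) (W : R -> T -> R) (hW : standard_wiener P W)
    (nu : R) (nu_gt0 : 0 < nu) (nu_neq2 : nu != 2)
    (A : R -> 'M[R]_2) (b : R -> 'cV[R]_2)
    (hA : (fun h : R => `|A h 0 0 - 1 + nu * h| + `|A h 0 1 + h|
                        + `|A h 1 0 - h| + `|A h 1 1 - 1|)
          =O_ (0^'+) (fun h : R => h ^+ 2))
    (hb : (fun h : R => `|b h 0 0 - 1| + `|b h 1 0|)
          =O_ (0^'+) (fun h : R => h)) :
  (\forall h \near 0^'+,
     (forall x, rate_formula (A h) (b h) h x = (Ih (A h) (b h) h x)%:C%C) /\
     exists mu : R -> probability (R * R)%type R,
       [/\ forall eps, 0 < eps ->
             unique_invariant_measure P W (A h) (b h) h eps (mu eps),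
           good_rate_function (EFin \o Ih (A h) (b h) h)
         & LDP mu (EFin \o Ih (A h) (b h) h)]) /\
  (asymptotically_preserves P W A b nu (fun h => EFin \o Ih (A h) (b h) h) /\
   forall p q : R,
     Ih (A h) (b h) h (p, q) @[h --> 0^'+] --> nu * (p ^+ 2 + q ^+ 2)).
Proof.
have near_facts := consistent_scheme_near nu_gt0 nu_neq2 hA hb.
have [kap kap01 near_contr] := consistent_scheme_contracts nu_gt0 hA.
have near_main : \forall h \near 0^'+,
     (forall x, rate_formula (A h) (b h) h x = (Ih (A h) (b h) h x)%:C%C) /\
     exists mu : R -> probability (R * R)%type R,
       [/\ forall eps, 0 < eps ->
             unique_invariant_measure P W (A h) (b h) h eps (mu eps),
           good_rate_function (EFin \o Ih (A h) (b h) h)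
         & LDP mu (EFin \o Ih (A h) (b h) h)].
  apply: filterS2 near_facts near_contr => h.
  move=> [[h0 a12 dn0 det0] [[d1 d2 d3] [S11 detS piv]]] [theta theta01 contr].
  split; first by move=> x; exact: rate_formula_real.
  exact: (scheme_large_deviations hW h0 a12 dn0 det0 d1 d2 d3 S11 detS piv kap01 theta01).
have limit (p q : R) : Ih (A h) (b h) h (p, q) @[h --> 0^'+] --> nu * (p ^+ 2 + q ^+ 2).
  have [l11 l12 l22] := lyapunov_cvg nu_gt0 hA hb.
  pose num h := h * lyapunov22 (A h) (b h) * (p * p) + h * lyapunov11 (A h) (b h) * (q * q)
    + - (2 * p * q * (h * lyapunov12 (A h) (b h))).
  pose den h := 2 * (h * lyapunov11 (A h) (b h) * (h * lyapunov22 (A h) (b h))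
    + - (h * lyapunov12 (A h) (b h) * (h * lyapunov12 (A h) (b h)))).
  have num_cvg : num h @[h --> 0^'+] -->
      (2 * nu)^-1 * (p * p) + (2 * nu)^-1 * (q * q) + - (2 * p * q * 0).
    apply: (@cvgD _ R^o); [apply: (@cvgD _ R^o)|apply: (@cvgN _ R^o)].
    - by apply: cvgM l22 _; exact: cvg_cst.
    - by apply: cvgM l11 _; exact: cvg_cst.
    - by apply: cvgM _ l12; exact: cvg_cst.
  have den_cvg : den h @[h --> 0^'+] --> 2 * ((2 * nu)^-1 * (2 * nu)^-1 + - (0 * 0)).
    apply: cvgM; first exact: cvg_cst.
    apply: (@cvgD _ R^o); first exact: (cvgM l11 l22).
    by apply: (@cvgN _ R^o); exact: (cvgM l12 l12).
  have nu0 : nu != 0 by rewrite gt_eqF.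
  have den0 : 2 * ((2 * nu)^-1 * (2 * nu)^-1 + - (0 * 0)) != 0.
    by rewrite mul0r oppr0 addr0 !mulf_neq0// invr_neq0// mulf_neq0.
  have -> : nu * (p ^+ 2 + q ^+ 2) =
      ((2 * nu)^-1 * (p * p) + (2 * nu)^-1 * (q * q) + - (2 * p * q * 0)) /
      (2 * ((2 * nu)^-1 * (2 * nu)^-1 + - (0 * 0))) by field.
  apply: (cvg_trans (near_eq_cvg _)); last first.
    by apply: cvgM num_cvg _; exact: (cvgV den0 den_cvg).
  apply: filterS near_facts => h.
  move=> [[h0 a12 dn0 det0] [[d1 d2 d3] [S11 detS piv]]].
  rewrite IhE//= /num /den; have hn0 : h != 0 by rewrite gt_eqF.
  move: detS; rewrite /lyapunov_det => /lt0r_neq0 dS0.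
  have -> : 2 * (h * lyapunov11 (A h) (b h) * (h * lyapunov22 (A h) (b h))
      + - (h * lyapunov12 (A h) (b h) * (h * lyapunov12 (A h) (b h)))) =
      2 * h ^+ 2 * (lyapunov11 (A h) (b h) * lyapunov22 (A h) (b h) - lyapunov12 (A h) (b h) ^+ 2).
    by ring.
  by field; rewrite ?hn0 ?dS0.
split => //; split => //; split.
- have : \forall h \near 0^'+, exists mu : R -> probability (R * R)%type R,
      (\forall eps \near 0^'+, unique_invariant_measure P W (A h) (b h) h eps (mu eps)) /\
      LDP mu (EFin \o Ih (A h) (b h) h).
    apply: filterS near_main => h [_ [mu [inv _ ldp]]]; exists mu; split => //.
    by near=> eps; apply: inv; near: eps; exact: nbhs_right_gt.
  move=> [e /= e0 He]; exists (e / 2); first by rewrite divr_gt0.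
  move=> h h_gt0 he; have [|mu [inv ldp]] := He h _ h_gt0; last by exists mu.
  by rewrite /ball/= sub0r normrN gtr0_norm// (le_lt_trans he)// ltr_pdivrMr// ltr_pMr// ltr1n.
- by move=> [p q]; apply: cvg_EFin; [exact: nearW|exact: limit].
Unshelve. all: by end_near. Qed.
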